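(* Let $X=\{X_n:n\ge 0\}$ be a sequence of real-valued random variables on a probability space $(\Omega,\mathcal F,\mathbb P)$ with $X_0=0$ and $\mathbb E[X_n]=0$ for all $n\ge 1$. Assume that $X$ satisfies the following four conditions. (A1) There exist a slowly varying function $L$, a number $a\in(0,1]$ and a function $g:\mathbb N\to\mathbb R_+$ with $g(n)\sim n^aL(n)$ such that, for some constant $C>0$ and all integers $n_1<n_2$, $$\left|\mathbb E\left[\left(\frac{X_{n_2}-X_{n_1}}{g(n_2-n_1)}\right)^2\right]-1\right|\le \frac{C}{1+\log(n_2-n_1)}.$$ (A2) For every pair of integers $n,p\ge 1$, $\limsup_{a\to\infty}\mathbb E[(X_{a+n}-X_a)^{2p}]<\infty$. (A3) With $g$ as in (A1) and $G$ a standard Gaussian random variable, there exist constants $C,\lambda>0$ such that for all $\theta\ge 1$ and all integers $n_2>n_1$, $$W_\theta\left(\frac{X_{n_2}-X_{n_1}}{g(n_2-n_1)},G\right)\le C\,\alpha(\theta)\,\frac{\theta^\lambda}{1+\log(n_2-n_1)},$$ where $\alpha(1)=1$ and $\alpha(\theta)=(\theta-1)^{1/2}$ for $\theta>1$, and moreover $$d_{\mathrm K}\left(\frac{X_{n_2}-X_{n_1}}{g(n_2-n_1)},G\right)\le \frac{C}{1+\log(n_2-n_1)}.$$ (A4) There is a fixed $q>1$ such that for every $\alpha>0$ there exists a constant $C_{\alpha,q}$ such that for all integers $d,m\ge 1$, setting $n_i=[q^{(m+i)^{1+\alpha}}]$ for $1\le i\le 2d$ (where $[x]$ is the integer part of $x$)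 and $$\mathbf Y=\left(\frac{X_{n_2}-X_{n_1}}{g(n_2-n_1)},\frac{X_{n_4}-X_{n_3}}{g(n_4-n_3)},\dots,\frac{X_{n_{2d}}-X_{n_{2d-1}}}{g(n_{2d}-n_{2d-1})}\right),$$ one has $W_1(\mathbf Y,\mathbf G)\le \dfrac{d\,C_{\alpha,q}}{1+\log(n_2-n_1)}$, where $\mathbf G$ is a $d$-dimensional vector of i.i.d. standard Gaussian random variables. Then, almost surely, $$\limsup_{n\to\infty}\frac{X_n}{\sqrt{2g^2(n)\log\log n}}=1\qquad\text{and}\qquad \liminf_{n\to\infty}\frac{X_n}{\sqrt{2g^2(n)\log\log n}}=-1.$$
   Context: A function $L$ is slowly varying if $\lim_{x\to\infty}L(ax)/L(x)=1$ for every $a>0$. For sequences, $u_n\sim v_n$ means $u_n/v_n\to 1$. For random vectors $\mathbf Z,\mathbf Y$ in $\mathbb R^d$, the Kolmogorov distance is $d_{\mathrm K}(\mathbf Z,\mathbf Y)=\sup_Q|\mathbb P[\mathbf Z\in Q]-\mathbb P[\mathbf Y\in Q]|$, the supremum over all sets $Q=(-\infty,a_1]\times\dots\times(-\infty,a_d]$. For $\theta\ge 1$ and random vectors with finite $\theta$-th moments, the $\theta$-Wasserstein distance is $W_\theta(\mathbf Z,\mathbf Y)=\inf(\mathbb E\|\mathbf U-\mathbf V\|^\theta)^{1/\theta}$, the infimum over all couplings $(\mathbf U,\mathbf V)$ with $\mathbf U\overset{law}{=}\mathbf Z$, $\mathbf V\overset{law}{=}\mathbf Y$, with $\|\cdot\|$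 the Euclidean norm. *)

(* Defs.v *)
From HB Require Import structures.
From mathcomp Require Import all_boot all_order all_algebra.
From mathcomp Require Import all_classical all_reals all_analysis.
From mathcomp Require Import normal_distribution.
Set Implicit Arguments. Unset Strict Implicit. Unset Printing Implicit Defensive.
Import Order.TTheory GRing.Theory Num.Theory.
Import numFieldNormedType.Exports.
Local Open Scope classical_set_scope.
Local Open Scope ring_scope.

Section defs.
Context {R : realType}.

Definition slowly_varying (L : R -> R) : Prop :=
  forall a : R, 0 < a -> L (a * x) / L x @[x --> +oo] --> (1 : R).

Definition asympt_equiv (u v : nat -> R) : Prop :=
  u n / v n @[n --> \oo] --> (1 : R).

Definition vec (d : nat) := 'I_d -> R.

Definition enorm d (v : vec d) : R := Num.sqrt (\sum_(i < d) v i ^+ 2).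

Definition vborel d : set (set (vec d)) :=
  <<s [set B | exists (i : 'I_d) (A : set R), measurable A /\
               B = (fun v : vec d => v i) @^-1` A] >>.

Definition rvec d {dT} {T : measurableType dT} (U : T -> vec d) : Prop :=
  forall i : 'I_d, measurable_fun setT (fun w => U w i).

Definition same_law d {dA} {TA : measurableType dA} (PA : probability TA R)
  (Z : TA -> vec d) {dB} {TB : measurableType dB} (PB : probability TB R)
  (Y : TB -> vec d) : Prop :=
  forall B, vborel B -> PA (Z @^-1` B) = PB (Y @^-1` B).

Definition wasserstein (theta : R) d {dA} {TA : measurableType dA}
  (PA : probability TA R) (Z : TA -> vec d) {dB} {TB : measurableType dB}
  (PB : probability TB R) (Y : TB -> vec d) : \bar R :=
  ereal_inf [set e | exists (dT : measure_display) (T : measurableType dT)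
     (Q : probability T R) (U V : T -> vec d),
     [/\ rvec U, rvec V, same_law Q U PA Z, same_law Q V PB Y &
      e = poweR (\int[Q]_w ((enorm (fun i => U w i - V w i)) `^ theta)%:E)
                theta^-1]].

Definition orthant d (a : vec d) : set (vec d) := [set v | forall i, v i <= a i].

Definition kolmogorov d {dA} {TA : measurableType dA}
  (PA : probability TA R) (Z : TA -> vec d) {dB} {TB : measurableType dB}
  (PB : probability TB R) (Y : TB -> vec d) : \bar R :=
  ereal_sup [set `| PA (Z @^-1` orthant a) - PB (Y @^-1` orthant a) |%E
            | a in [set: vec d]].

Definition std_gauss_vec d {dT} {T : measurableType dT} (Q : probability T R)
  (G : T -> vec d) : Prop :=
  [/\ rvec G,
      (forall (i : 'I_d) (A : set R), measurable A ->
         Q ((fun w => G w i) @^-1` A) = normal_prob 0 1 A) &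
      (forall B : 'I_d -> set R, (forall i, measurable (B i)) ->
         Q (\bigcap_(i in [set: 'I_d]) ((fun w => G w i) @^-1` B i)) =
         (\prod_(i < d) Q ((fun w => G w i) @^-1` B i))%E)].

Definition alphaW (theta : R) : R :=
  if theta == 1 then 1 else Num.sqrt (theta - 1).

End defs.

(* Main.v *)
Require Import Defs.
From HB Require Import structures.
From mathcomp Require Import all_boot all_order all_algebra.
From mathcomp Require Import all_classical all_reals all_analysis.
From mathcomp Require Import normal_distribution measurable_realfun.
From mathcomp Require Import ring lra zify.
Import Order.TTheory GRing.Theory Num.Theory.
Import numFieldNormedType.Exports.
Local Open Scope classical_set_scope.
Local Open Scope ring_scope.
Set Implicit Arguments. Unset Strict Implicit. Unset Printing Implicit Defensive.

(** Write [s n := sqrt (2 ln ln n)].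

    Upper bound. For a fixed order [p], a nearly optimal coupling turns (A3) into
    [P (|X_n2 - X_n1| > (x + y) g l) <= 2 exp (- x^2 / 2) + (C_p / ((1 + ln l) y))^p]
    with [l = n2 - n1]; along dyadic scales the last term is summable as soon as
    [p >= 2]. Chaining through the binary expansion of [n] then shows that, almost
    surely, [X_n] differs from its value at the leading [j] binary digits of [n] by
    at most [D rho^j g(2^J) s(2^J)] when [2^J <= n < 2^(J+1)], and the finitely many
    block starts at each scale are handled by Borel-Cantelli.

    Lower bound. Among the [m] increments of (A4) that start at index [m], the joint
    law is within [O(m^(-al))] of independent Gaussians, so the probability that
    none of them exceeds [(1 - eps) s] tends to 0. Exceedances therefore occur
    infinitely often, and [X] at the left end of the increment is negligible by the
    upper bound. *)

(** The chain has to beat [2 ^ j] links at level [j] with tails that are Gaussian only up to a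
    polynomial error. The growth of [g] supplies the room: a dyadic step multiplies [g] by nearly
    [2 ^ a], of which only [rho ^ -2 = 2 ^ (a / 2)] is kept. Of these two powers of [rho], one
    raises the threshold at level [j] by [rho ^ -j]; the other remains as the geometric weight that
    makes the chain summable. The order [p] is chosen after [rho], so that [rho ^ p] beats the
    number of links in the polynomial term too.

    In the lower bound, the times of (A4) grow faster than geometrically, which inflates [ln ln] by
    [1 + al], and the error grows with the number [d] of increments. Taking [d = m] and [al = eps]
    balances both: an independent Gaussian exceeds the level with probability at least of order
    [m ^ (-(1 - eps ^ 2))], so that [m ^ (eps ^ 2)] exceedances are expected, while the error is of
    order [m / m ^ (1 + eps)]. A sign [sg] carries both tails through the argument, so the limit
    inferior needs no second proof. *)

Section basics.
Context {R : realType}.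

Lemma measurable_set_ltr d (T : measurableType d) (f h : T -> R) :
  measurable_fun setT f -> measurable_fun setT h ->
  measurable [set w | f w < h w].
Proof.
move=> mf mh; have := measurable_fun_ltr mf mh.
move=> /(_ measurableT [set true] ltac:(by [])); rewrite setTI.
by congr (measurable _); apply/seteqP; split => w /= ->.
Qed.

Lemma measurable_set_ler d (T : measurableType d) (f h : T -> R) :
  measurable_fun setT f -> measurable_fun setT h ->
  measurable [set w | f w <= h w].
Proof.
move=> mf mh; have := measurable_fun_ler mf mh.
move=> /(_ measurableT [set true] ltac:(by [])); rewrite setTI.
by congr (measurable _); apply/seteqP; split => w /= ->.
Qed.

Lemma markov_ge d (T : measurableType d) (Q : probability T R) (f : T -> R)
    (t c : R) : measurable_fun setT f -> (forall w, 0 <= f w) -> 0 < t ->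
  (\int[Q]_w (f w)%:E <= c%:E)%E -> (Q [set w | t <= f w]%R <= (c / t)%:E)%E.
Proof.
move=> mf f0 t0 Ic.
have mA : measurable [set w | t <= f w] by apply: measurable_set_ler.
rewrite EFinM lee_pdivlMr // muleC; apply: le_trans Ic.
rewrite -integral_cst //.
apply: (@le_trans _ _ (\int[Q]_(w in [set w | (t <= f w)%R]) (f w)%:E)%E).
  apply: ge0_le_integral => //=.
  - by move=> x _; rewrite lee_fin ltW.
  - by apply/measurable_EFinP/measurable_funTS.
apply: ge0_subset_integral => //.
- exact/measurable_EFinP.
- by move=> x _; rewrite lee_fin.
Qed.

End basics.

(** * Gaussian tails *)

Section gauss.
Context {R : realType}.
Notation mu := (@lebesgue_measure R).

Lemma normal_pdf1 (m x : R) :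
  normal_pdf m 1 x = normal_peak 1 * expR (- (x - m) ^+ 2 / 2).
Proof.
rewrite normal_pdfE ?oner_eq0 // /normal_fun; congr (_ * expR (_ / _)).
by rewrite expr1n.
Qed.

(* Completing the square: on [A] the density of N(0,1) is at most
   [expR (- x ^+ 2 / 2)] times that of N(x,1). *)
Lemma normal_prob_le_expR (x : R) (A : set R) : measurable A ->
  (forall y, A y -> x ^+ 2 <= x * y) ->
  (normal_prob 0 1 A <= (expR (- x ^+ 2 / 2))%:E)%E.
Proof.
move=> mA Ax.
have h : (normal_prob 0 1 A <= (expR (- x ^+ 2 / 2))%:E * normal_prob x 1 A)%E.
  have mpdf (m : R) : measurable_fun A (fun y => (normal_pdf m 1 y)%:E).
    by apply/measurable_EFinP/measurable_funTS; exact: measurable_normal_pdf.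
  have pdf0 (m y : R) : A y -> (0 <= (normal_pdf m 1 y)%:E)%E.
    by move=> _; rewrite lee_fin normal_pdf_ge0.
  have -> : ((expR (- x ^+ 2 / 2))%:E * normal_prob x 1 A =
      \int[mu]_(y in A) (expR (- x ^+ 2 / 2) * normal_pdf x 1 y)%:E)%E.
    under [RHS]eq_integral do rewrite EFinM.
    by rewrite ge0_integralZl_EFin ?expR_ge0 //; [move=> y; exact: pdf0|exact: mpdf].
  apply: ge0_le_integral => //.
  - by move=> y; exact: pdf0.
  - exact: mpdf.
  - apply/measurable_EFinP; apply: measurable_funM => //.
    by apply: measurable_funTS; exact: measurable_normal_pdf.
  move=> y Ay; rewrite lee_fin !normal_pdf1 mulrCA -expRD.
  apply: ler_wpM2l; first exact: normal_peak_ge0.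
  by rewrite ler_expR; have := Ax _ Ay; nra.
apply: (le_trans h); rewrite -[leRHS]mule1; apply: lee_wpmul2l.
  by rewrite lee_fin expR_ge0.
exact: probability_le1.
Qed.

Lemma normal_tail_le (x : R) : 0 <= x ->
  (normal_prob 0 1 [set y : R | (x < `|y|)%R] <= (2 * expR (- x ^+ 2 / 2))%:E)%E.
Proof.
move=> x0.
have -> : [set y : R | x < `|y|] = [set y | x < y] `|` [set y | y < - x].
  apply/seteqP; split => y /=; rewrite ltr_normr.
    by move=> /orP[|?]; [left|right; lra].
  by case=> ?; apply/orP; [left|right; lra].
apply: le_trans (measureU2 _ _ _) _.
- exact: measurable_set_ltr.
- exact: measurable_set_ltr.
have -> : (2 * expR (- x ^+ 2 / 2))%:E =
   ((expR (- x ^+ 2 / 2))%:E + (expR (- (- x) ^+ 2 / 2))%:E)%E.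
  by rewrite -EFinD sqrrN; congr (_%:E); ring.
apply: leeD; apply: normal_prob_le_expR.
- exact: measurable_set_ltr.
- by move=> y /= ?; nra.
- exact: measurable_set_ltr.
- by move=> y /= ?; nra.
Qed.

(** On the unit interval just beyond the threshold the density is smallest at distance [x + 1] from
    0. Replacing [x] by [x + 1] is harmless to leading order in the exponent. *)
Lemma normal_tail_ge (sg x : R) : sg = 1 \/ sg = -1 -> 0 <= x ->
  ((normal_peak 1 * expR (- (x + 1) ^+ 2 / 2))%:E
     <= normal_prob 0 1 [set y : R | (x < sg * y)%R])%E.
Proof.
move=> sg1 x0.
have mA : measurable [set y : R | (x < sg * y)%R].
  by apply: measurable_set_ltr => //; exact: measurable_funM.
have H (c : R) : (`]c, (c + 1)[ `<=` [set y : R | (x < sg * y)%R]) ->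
    (forall y, c < y < c + 1 -> `|y| <= x + 1) ->
    ((normal_peak 1 * expR (- (x + 1) ^+ 2 / 2))%:E
     <= normal_prob 0 1 [set y : R | (x < sg * y)%R])%E.
  move=> cA cx; rewrite /normal_prob.
  pose I : set R := `]c, (c + 1)[%classic.
  have mI : measurable I by exact: measurable_itv.
  apply: (@le_trans _ _ (\int[mu]_(y in I) (normal_pdf 0 1 y)%:E)%E); last first.
    apply: ge0_subset_integral => //.
    - by apply/measurable_EFinP/measurable_funTS; exact: measurable_normal_pdf.
    - by move=> y _; rewrite lee_fin normal_pdf_ge0.
  set k := normal_peak 1 * _.
  have k0 : 0 <= k by rewrite mulr_ge0 ?normal_peak_ge0 ?expR_ge0.
  apply: (@le_trans _ _ (\int[mu]_(y in I) k%:E)%E).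
    rewrite integral_cst // /= lebesgue_measure_itv /= lte_fin ltrDl ltr01.
    by rewrite -EFinB -EFinM lee_fin addrAC subrr add0r mulr1.
  apply: ge0_le_integral => //.
    - by apply/measurable_EFinP/measurable_funTS; exact: measurable_normal_pdf.
  move=> y; rewrite /I /= in_itv /= => /cx yx.
  rewrite lee_fin normal_pdf1 /k subr0; apply: ler_wpM2l.
    exact: normal_peak_ge0.
  rewrite ler_expR ler_pM2r ?invr_gt0 // lerN2 -(real_normK (num_real y)).
  by rewrite ler_sqr // nnegrE; lra.
case: sg1 => sgE; [apply: (H x)|apply: (H (- (x + 1)))].
- by move=> y /=; rewrite in_itv /= sgE mul1r => /andP[].
- by move=> y /andP[? ?]; rewrite ler_norml; apply/andP; split; lra.
- by move=> y /=; rewrite in_itv /= sgE mulN1r => /andP[? ?]; lra.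
- by move=> y /andP[? ?]; rewrite ler_norml; apply/andP; split; lra.
Qed.

End gauss.

(** * Existence of standard Gaussian vectors *)

Section gauss_vector.
Context {R : realType}.

(** The clauses of [std_gauss_vec] inspect the law on rectangles only, so the values of [M] there
    are all that is asked of it. *)
Lemma std_gauss_vec_cons d (dT : measure_display) (T : measurableType dT)
    (Q : probability T R) (G : T -> vec d) (dS : measure_display)
    (S : measurableType dS) (N : probability S R) (h : S -> R)
    (M : probability (T * S)%type R) :
  (forall A B, measurable A -> measurable B -> M (A `*` B) = (Q A * N B)%E) ->
  std_gauss_vec Q G -> measurable_fun setT h ->
  (forall A : set R, measurable A -> N (h @^-1` A) = normal_prob 0 1 A) ->
  std_gauss_vec M (fun w (i : 'I_d.+1) =>
    if unlift ord0 i is Some j then G w.1 j else h w.2).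
Proof.
move=> rect [rG lG iG] mh lh; set G' := (fun w _ => _).
have G'0 w : G' w ord0 = h w.2 by rewrite /G' unlift_none.
have G'S w j : G' w (lift ord0 j) = G w.1 j by rewrite /G' liftK.
have mhA A : measurable A -> measurable (h @^-1` A).
  by move=> mA; rewrite -[X in measurable X]setTI; exact: mh.
have mGA j A : measurable A -> measurable ((fun w => G w j) @^-1` A).
  by move=> mA; rewrite -[X in measurable X]setTI; exact: rG.
have l0 A : measurable A ->
    M ((fun w => G' w ord0) @^-1` A) = N (h @^-1` A).
  move=> mA.
  have -> : (fun w => G' w ord0) @^-1` A = setT `*` (h @^-1` A).
    by apply/seteqP; split => w /=; rewrite G'0 // => -[].
  by rewrite rect ?probability_setT ?mul1e //; exact: mhA.
have l1 A j : measurable A ->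
    M ((fun w => G' w (lift ord0 j)) @^-1` A) = Q ((fun w => G w j) @^-1` A).
  move=> mA.
  have -> : (fun w => G' w (lift ord0 j)) @^-1` A =
      ((fun w => G w j) @^-1` A) `*` setT.
    by apply/seteqP; split => w /=; rewrite G'S // => -[].
  by rewrite rect ?probability_setT ?mule1 //; exact: mGA.
split.
- move=> i; case: (unliftP ord0 i) => [j ->|->].
    under eq_fun do rewrite G'S.
    by apply: (measurableT_comp (rG j)); exact: measurable_fst.
  under eq_fun do rewrite G'0.
  by apply: (measurableT_comp mh); exact: measurable_snd.
- move=> i A mA; case: (unliftP ord0 i) => [j ->|->]; first by rewrite l1 // lG.
  by rewrite l0 // lh.
- move=> B mB.
  have -> : \bigcap_(i in [set: 'I_d.+1]) ((fun w => G' w i) @^-1` B i) =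
    (\bigcap_(i in [set: 'I_d]) ((fun w => G w i) @^-1` B (lift ord0 i)))
      `*` (h @^-1` B ord0).
    apply/seteqP; split => w /=.
      move=> H; split; last by have := H ord0 I; rewrite /= G'0.
      by move=> j _ /=; have := H (lift ord0 j) I; rewrite /= G'S.
    move=> [H H0] i _ /=; case: (unliftP ord0 i) => [j ->|->].
      by rewrite G'S; exact: H.
    by rewrite G'0.
  rewrite rect //; last 2 first.
  - by apply: fin_bigcap_measurable => // j _; exact: mGA.
  - exact: mhA.
  rewrite iG // big_ord_recl muleC l0 //; congr (_ * _)%E.
  by apply: eq_bigr => j _; rewrite l1.
Qed.

(** (A3) and (A4) are stated for every standard Gaussian vector on any space, so they yield nothing
    until one is exhibited. *)
Lemma std_gauss_vec_exists (d : nat) :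
  exists (dT : measure_display) (T : measurableType dT)
    (Q : probability T R) (G : T -> vec d), std_gauss_vec Q G.
Proof.
pose N1 : probability _ R := normal_prob 0 1.
elim: d => [|d [dT [T [Q [G gG]]]]].
  exists _, _, N1, (fun _ _ => 0); split.
  - by case.
  - by case.
  - move=> B _; rewrite big_ord0 -[RHS](@probability_setT _ _ R N1).
    by congr (N1 _); apply/seteqP; split => // w _ [].
exists _, _, (Q \x N1)%E, (fun w (i : 'I_d.+1) =>
    if unlift ord0 i is Some j then G w.1 j else w.2).
apply: (@std_gauss_vec_cons d _ _ Q G _ _ N1 id) => //.
by move=> A B mA mB; exact: product_measure1E.
Qed.

End gauss_vector.

(** * Tail events through couplings *)

Section coupling.
Context {R : realType}.

Lemma measurable_enorm d dT (T : measurableType dT) (U V : T -> @vec R d) :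
  rvec U -> rvec V ->
  measurable_fun setT (fun w => enorm (fun i => U w i - V w i)).
Proof.
move=> mU mV; rewrite /enorm.
have -> : (fun w => Num.sqrt (\sum_(i < d) (U w i - V w i) ^+ 2)) =
    (fun w => (\sum_(i < d) (U w i - V w i) ^+ 2) `^ 2^-1).
  apply/funext => w; rewrite powR12_sqrt // sumr_ge0 // => i _; exact: sqr_ge0.
apply: (measurableT_comp (measurable_powR _)).
apply: measurable_sum => i.
by apply: measurable_funX; apply: measurable_funB.
Qed.

Lemma ler_enorm d (v : @vec R d) i : `|v i| <= enorm v.
Proof.
rewrite /enorm -sqrtr_sqr; apply: ler_wsqrtr.
by rewrite (bigD1 i) //= lerDl sumr_ge0 // => j _; exact: sqr_ge0.
Qed.

(** A strict bound on the infimum selects an actual coupling, and Markov's inequality for the power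
    [p] of the distance gives the tail. One coupling serves all [y]. *)
Lemma wasserstein_coupling (p : nat) (r : R) d dA (TA : measurableType dA)
    (PA : probability TA R) (Z : TA -> vec d) dB (TB : measurableType dB)
    (PB : probability TB R) (Y : TB -> vec d) : (0 < p)%N -> 0 <= r ->
  (wasserstein p%:R PA Z PB Y < r%:E)%E ->
  exists (dT : measure_display) (T : measurableType dT)
     (Q : probability T R) (U V : T -> vec d),
     [/\ rvec U, rvec V, same_law Q U PA Z, same_law Q V PB Y &
      forall y : R, 0 < y ->
        (Q [set w | y <= enorm (fun i => U w i - V w i)]%R <= ((r / y) ^+ p)%:E)%E].
Proof.
move=> p0 r0 /ereal_inf_lt[_ [dT [T [Q [U [V [mU mV lU lV ->]]]]]] Wr].
exists dT, T, Q, U, V; split => // y y0.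
have p0R : (0 : R) < p%:R by rewrite ltr0n.
have mE := measurable_enorm mU mV.
set I := (\int[Q]_w _)%E in Wr.
have I0 : (0 <= I)%E.
  by apply: integral_ge0 => w _; rewrite lee_fin powR_ge0.
(* [Wr] raised to the power [p]; the value [+oo] is excluded because its root is infinite. *)
have Ir : (I <= (r ^+ p)%:E)%E.
  move: Wr I0; case: I => [s| |] //=.
    rewrite lte_fin !lee_fin => sr s0.
    have -> : s = (s `^ p%:R^-1) ^+ p.
      by rewrite -powR_mulrn ?powR_ge0 // -powRrM mulVf ?gt_eqF // powRr1.
    by apply: lerXn2r; rewrite ?nnegrE ?powR_ge0 // ltW.
  by rewrite gt_eqF ?invr_gt0.
rewrite expr_div_n.
have -> : [set w | y <= enorm (fun i => U w i - V w i)] =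
   [set w | y ^+ p <= (enorm (fun i => U w i - V w i)) `^ p%:R].
  apply/seteqP; split => w /=; rewrite powR_mulrn ?sqrtr_ge0 //.
    by move=> h; apply: lerXn2r; rewrite ?nnegrE ?sqrtr_ge0 // ltW.
  by rewrite ler_pXn2r // nnegrE ?sqrtr_ge0 // ltW.
apply: markov_ge => //.
- by apply: (measurableT_comp (measurable_powR _)).
- by move=> w; rewrite powR_ge0.
- by rewrite exprn_gt0.
Qed.

Lemma vborel_bigcap d (B : 'I_d -> set R) : (forall i, measurable (B i)) ->
  vborel [set v : @vec R d | forall i, B i (v i)].
Proof.
move=> mB.
pose C := [set B | exists (i : 'I_d) (A : set R), measurable A /\
               B = (fun v : @vec R d => v i) @^-1` A].
have -> : [set v : vec d | forall i, B i (v i)] =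
   \bigcap_(i in [set: 'I_d]) ((fun v : @vec R d => v i) @^-1` B i).
  by apply/seteqP; split => v /= H i; [move=> _|]; exact: H.
have := @fin_bigcap_measurable _ (g_sigma_algebraType C) _ [set: 'I_d]
  (fun i => (fun v : @vec R d => v i) @^-1` B i).
apply => // i _; apply: sub_sigma_algebra.
by exists i, (B i).
Qed.

(** In a coupling [(U, V)], [|U| > x + y] forces [|V| > x] or [|U - V| >= y]: the first event has
    the Gaussian tail, the second the polynomial one. *)
Lemma wasserstein_tail (p : nat) (r x y : R) dA (TA : measurableType dA)
    (PA : probability TA R) (Z : TA -> vec 1) dB (TB : measurableType dB)
    (PB : probability TB R) (Y : TB -> vec 1) : (0 < p)%N -> 0 <= r ->
  0 <= x -> 0 < y -> std_gauss_vec PB Y ->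
  (wasserstein p%:R PA Z PB Y < r%:E)%E ->
  (PA [set w | x + y < `|Z w ord0| ]%R
     <= (2 * expR (- x ^+ 2 / 2) + (r / y) ^+ p)%:E)%E.
Proof.
move=> p0 r0 x0 y0 [_ lY _] /(wasserstein_coupling p0 r0).
move=> [dT [T [Q [U [V [mU mV lU lV QW]]]]]].
have mS (t : R) : measurable [set u : R | t < `|u|].
  by apply: measurable_set_ltr => //; exact: measurableT_comp.
(* [same_law] compares preimages of [vborel] sets only, so events are first brought into that
   shape. *)
have preE (S : set R) TT (W : TT -> vec 1) :
    [set w | S (W w ord0)] = W @^-1` [set v | forall i, S (v i)].
  by apply/seteqP; split => w /= H; [move=> i; rewrite ord1|exact: H].
rewrite (preE [set u | x + y < `|u|]) -lU; last exact: (@vborel_bigcap 1 (fun=> _) (fun=> mS _)).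
rewrite -preE.
have mUV : measurable [set w | y <= enorm (fun i => U w i - V w i)].
  by apply: measurable_set_ler => //; exact: measurable_enorm.
have mV0 : measurable [set w | x < `|V w ord0| ].
  by apply: measurable_set_ltr => //; exact: measurableT_comp.
have mU0 : measurable [set w | x + y < `|U w ord0| ].
  by apply: measurable_set_ltr => //; exact: measurableT_comp.
apply: (@le_trans _ _ (Q ([set w | x < `|V w ord0| ] `|`
    [set w | y <= enorm (fun i => U w i - V w i)]))).
  apply: le_measure; rewrite ?inE //; first exact: measurableU.
  move=> w /= h; have [|h2] := ltP x `|V w ord0|; [by left|right].
  apply: le_trans (ler_enorm (fun i => U w i - V w i) ord0).
  have := ler_normD (U w ord0 - V w ord0) (V w ord0); rewrite subrK; lra.
have QU : (Q ([set w | x < `|V w ord0| ]%R `|`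
    [set w | y <= enorm (fun i => U w i - V w i)]%R) <=
    Q [set w | x < `|V w ord0| ]%R +
    Q [set w | y <= enorm (fun i => U w i - V w i)]%R)%E by exact: measureU2.
apply: (le_trans QU).
rewrite EFinD; apply: leeD; last exact: QW.
rewrite (preE [set u | x < `|u|]) lV; last exact: (@vborel_bigcap 1 (fun=> _) (fun=> mS _)).
rewrite -preE.
have -> : [set w | [set u | x < `|u|] (Y w ord0)] =
  (fun w => Y w ord0) @^-1` [set u | x < `|u|] by [].
by rewrite lY //; exact: normal_tail_le.
Qed.

Lemma prode_cst_le d (x : \bar R) (y : R) : (0 <= x)%E -> (x <= y%:E)%E ->
  (\prod_(i < d) x <= (y ^+ d)%:E)%E.
Proof.
move=> x0 xy; elim: d => [|d IH]; first by rewrite big_ord0 expr0.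
rewrite big_ord_recl exprS EFinM; apply: lee_pmul => //.
by apply: prode_ge0.
Qed.

(** Unless [U] and [V] are at distance at least 1, which has probability at most [r], all
    coordinates of [V] stay below [x + 1]. The Gaussian lower tail at [x + 1] costs a further unit,
    hence [x + 2]. *)
Lemma wasserstein_orthant d (r sg x : R) dA (TA : measurableType dA)
    (PA : probability TA R) (Z : TA -> vec d) dB (TB : measurableType dB)
    (PB : probability TB R) (Y : TB -> vec d) : 0 <= r ->
  sg = 1 \/ sg = -1 -> 0 <= x -> std_gauss_vec PB Y ->
  (wasserstein 1 PA Z PB Y < r%:E)%E ->
  (PA [set w | forall i, sg * Z w i <= x]%R <=
     ((1 - normal_peak 1 * expR (- (x + 2) ^+ 2 / 2)) ^+ d + r)%:E)%E.
Proof.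
move=> r0 sg1 x0 [mY lY iY] /(@wasserstein_coupling 1 r _ _ _ _ _ _ _ _ _ isT r0).
move=> [dT [T [Q [U [V [mU mV lU lV /(_ 1 ltr01)]]]]]]; rewrite divr1 expr1 => QW.
have sgE : `|sg| = 1 by case: sg1 => ->; rewrite ?normrN normr1.
have mS (t : R) : measurable [set u : R | sg * u <= t].
  by apply: measurable_set_ler => //; exact: measurable_funM.
have mUV : measurable [set w | 1 <= enorm (fun i => U w i - V w i)].
  by apply: measurable_set_ler => //; exact: measurable_enorm.
have mW t (W : T -> vec d) : rvec W -> measurable [set w | forall i, sg * W w i <= t].
  move=> rW.
  have -> : [set w | forall i, sg * W w i <= t] =
    \bigcap_(i in [set: 'I_d]) [set w | sg * W w i <= t].
    by apply/seteqP; split => w /= H i; [move=> _|]; exact: H.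
  apply: fin_bigcap_measurable => // i _; apply: measurable_set_ler => //.
  exact: measurable_funM.
have -> : [set w | forall i, sg * Z w i <= x] =
    Z @^-1` [set v | forall i, [set u | sg * u <= x] (v i)] by [].
rewrite -lU; last exact: (@vborel_bigcap d (fun=> _) (fun=> mS _)).
apply: (@le_trans _ _ (Q ([set w | forall i, sg * V w i <= x + 1] `|`
    [set w | 1 <= enorm (fun i => U w i - V w i)]))).
  apply: le_measure; rewrite ?inE //; [exact: mW|by apply: measurableU => //; exact: mW|].
  move=> w /= h.
  have [|h2] := leP 1 (enorm (fun i => U w i - V w i)); [by right|left => i].
  have := ler_enorm (fun i => U w i - V w i) i.
  rewrite -[`|U w i - V w i|]mul1r -sgE -normrM mulrBr => h3.
  have := ler_norm (- (sg * U w i - sg * V w i)); rewrite normrN.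
  by have := h i; lra.
have QU : (Q ([set w | forall i, sg * V w i <= x + 1]%R `|`
    [set w | 1 <= enorm (fun i => U w i - V w i)]%R) <=
    Q [set w | forall i, sg * V w i <= x + 1]%R +
    Q [set w | 1 <= enorm (fun i => U w i - V w i)]%R)%E.
  by apply: measureU2 => //; exact: mW.
apply: (le_trans QU).
rewrite EFinD; apply: leeD; last exact: QW.
have -> : [set w | forall i, sg * V w i <= x + 1] =
    V @^-1` [set v | forall i, [set u | sg * u <= x + 1] (v i)] by [].
rewrite lV; last exact: (@vborel_bigcap d (fun=> _) (fun=> mS _)).
have -> : Y @^-1` [set v | forall i, [set u | sg * u <= x + 1] (v i)] =
  \bigcap_(i in [set: 'I_d]) ((fun w => Y w i) @^-1` [set u | sg * u <= x + 1]).
  by apply/seteqP; split => w /= H i; [move=> _|]; exact: H.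
rewrite iY //.
have -> : (\prod_(i < d) PB ((fun w => Y w i) @^-1` [set u | sg * u <= x + 1]%R) =
  \prod_(i < d) (normal_prob 0 1 [set u | sg * u <= x + 1]%R))%E.
  by apply: eq_bigr => i _; rewrite lY.
have Nle : (normal_prob 0 1 [set u | sg * u <= x + 1]%R <=
   (1 - normal_peak 1 * expR (- (x + 2) ^+ 2 / 2))%:E)%E.
  have x1 : 0 <= x + 1 by lra.
  have := normal_tail_ge sg1 x1.
  have -> : [set u | sg * u <= x + 1] = ~` [set u | x + 1 < sg * u].
    by apply/seteqP; split => u /=; rewrite leNgt => /negP.
  rewrite [X in (_ -> X <= _)%E](probability_setC (normal_prob 0 1)); last first.
    by apply: measurable_set_ltr => //; exact: measurable_funM.
  rewrite EFinB; have -> : x + 1 + 1 = x + 2 by lra.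
  by move=> ?; apply: leeB.
exact: prode_cst_le.
Qed.

End coupling.

(** * Borel-Cantelli for events of probability [J ^ (-1 - eta)] *)

Section borel_cantelli_power.
Context d (T : measurableType d) (R : realType) (P : probability T R).

(** A discrete form of the integral comparison for [x ^ (-1 - eta)], with powers written as
    exponentials of logarithms; it makes the series telescope. *)
Lemma expR_ln_telescope (eta : R) (k : nat) : 0 < eta -> (0 < k)%N ->
  eta * expR (- (1 + eta) * ln k.+1%:R) <=
  expR (- eta * ln k%:R) - expR (- eta * ln k.+1%:R).
Proof.
move=> e0 k0.
have k1 : (0 : R) < k%:R by rewrite ltr0n.
have kS : (0 : R) < k.+1%:R by rewrite ltr0n.
have lnk : ln k%:R <= ln k.+1%:R - k.+1%:R^-1 :> R.
  have -> : k%:R = k.+1%:R * (1 - k.+1%:R^-1) :> R.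
    by rewrite mulrBr mulr1 divff ?gt_eqF // -natr1 addrK.
  have h : - (k.+1%:R^-1) > -1 :> R.
    by rewrite ltrN2 invf_lt1 // ltr1n ltnS.
  have h' : 0 < 1 - k.+1%:R^-1 :> R by rewrite subr_gt0 invf_lt1 // ltr1n ltnS.
  rewrite lnM ?posrE //.
  by rewrite lerD2l; exact: le_ln1Dx.
have -> : - (1 + eta) * ln k.+1%:R = - eta * ln k.+1%:R + (- ln k.+1%:R) by ring.
rewrite expRD expRN lnK ?posrE //.
have -> : - eta * ln k%:R = - eta * ln k.+1%:R + eta * (ln k.+1%:R - ln k%:R) by ring.
rewrite expRD.
have h1 := expR_ge1Dx (eta * (ln k.+1%:R - ln k%:R) : R).
set E := expR (- eta * ln k.+1%:R).
have E0 : 0 <= E by exact: expR_ge0.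
have h2 : eta * k.+1%:R^-1 <= eta * (ln k.+1%:R - ln k%:R).
  by rewrite ler_pM2l // lerBrDr addrC -lerBrDr.
have h3 : 1 + eta * k.+1%:R^-1 <= expR (eta * (ln k.+1%:R - ln k%:R)).
  by apply: le_trans h1; rewrite lerD2l.
move: (ler_wpM2l E0 h3); set u := k.+1%:R^-1; set v := expR (eta * _); lra.
Qed.

Lemma sum_expR_ln_le (eta : R) (N n : nat) : 0 < eta -> (0 < N)%N ->
  \sum_(0 <= k < n) expR (- (1 + eta) * ln (k + N.+1)%N%:R) <= eta^-1.
Proof.
move=> e0 N0.
suff h : eta * \sum_(0 <= k < n) expR (- (1 + eta) * ln (k + N.+1)%N%:R) <=
    expR (- eta * ln N%:R) - expR (- eta * ln (n + N)%N%:R).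
  have h1 : expR (- eta * ln N%:R) <= 1 :> R.
    by rewrite expR_le1 mulNr oppr_le0 (mulr_ge0 (ltW e0)) // ln_ge0 // ler1n.
  have h2 := expR_ge0 (- eta * ln (n + N)%N%:R : R).
  by rewrite -[leRHS]mulr1 -ler_pdivrMl ?invr_gt0 // invrK; lra.
elim: n => [|n IH]; first by rewrite big_nil mulr0 subrr.
rewrite big_nat_recr //= mulrDr addnS addSn.
by have := @expR_ln_telescope eta (n + N)%N e0 ltac:(lia); lra.
Qed.

Lemma borel_cantelli_power (A : nat -> set T) (K eta : R) :
  (forall J, measurable (A J)) -> 0 < eta ->
  (\forall J \near \oo, (P (A J) <= (K * expR (- (1 + eta) * ln J%:R))%:E)%E) ->
  {ae P, forall w, \forall J \near \oo, ~ A J w}.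
Proof.
move=> mA e0 [M _ PA].
pose N := M.+1.
(* The shift starts the sequence where the assumed bound holds and where [sum_expR_ln_le]
   applies. *)
pose B k := A (k + N.+1)%N.
have PB k : (P (B k) <= (`|K| * expR (- (1 + eta) * ln (k + N.+1)%N%:R))%:E)%E.
  apply: le_trans (PA _ _) _; first by rewrite /=; lia.
  by rewrite lee_fin ler_wpM2r ?expR_ge0 // ler_norm.
have B0 : P (lim_sup_set B) = 0%E.
  apply: lim_sup_set_cvg0; first by move=> k; exact: mA.
  apply: (@le_lt_trans _ _ (`|K| * eta^-1)%:E); last exact: ltry.
  apply: lime_le; first exact: is_cvg_nneseries.
  apply: nearW => n.
  apply: (@le_trans _ _ (\sum_(0 <= k < n)
     (`|K| * expR (- (1 + eta) * ln (k + N.+1)%N%:R))%:E)%E).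
    by apply: lee_sum => k _; exact: PB.
  rewrite sumEFin lee_fin -mulr_sumr ler_wpM2l //.
  exact: sum_expR_ln_le.
exists (lim_sup_set B); split => //.
  apply: bigcapT_measurable => n; apply: bigcup_measurable => k _; exact: mA.
move=> w /= nA n _ /=.
apply: contrapT => nB; apply: nA; exists (n + N.+1)%N => //= J /= nJ AJ.
apply: nB; exists (J - N.+1)%N => /=; first lia.
by rewrite /B subnK //; lia.
Qed.

Lemma union_bound (n : nat) (A : nat -> set T) (b : nat -> R) :
  (forall i, (i < n)%N -> measurable (A i)) ->
  (forall i, (i < n)%N -> (P (A i) <= (b i)%:E)%E) ->
  measurable [set w | exists2 i, (i < n)%N & A i w] /\
  (P [set w | exists2 i, (i < n)%N & A i w] <= (\sum_(i < n) b i)%:E)%E.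
Proof.
move=> mA PA.
have -> : [set w | exists2 i, (i < n)%N & A i w] = \big[setU/set0]_(i < n) A i.
  by rewrite -bigcup_mkord; apply/seteqP; split => w [i ? ?]; exists i.
split; first by apply: bigsetU_measurable => i _; exact: mA.
apply: le_trans (Boole_inequality _ _) _; first by move=> i; exact: mA.
by rewrite -sumEFin; apply: lee_sum => i _; exact: PA.
Qed.

End borel_cantelli_power.

(** * Binary truncation and chaining *)

Section dyadic.

Definition dyadic_floor (i n : nat) : nat := (n %/ 2 ^ i * 2 ^ i)%N.

(** The quotient [n %/ 2 ^ i] is even or odd. Hence a link of the chain is empty or has length
    exactly [2 ^ i]. *)
Lemma dyadic_floorS i n :
  dyadic_floor i n = dyadic_floor i.+1 n \/
  dyadic_floor i n = (dyadic_floor i.+1 n + 2 ^ i)%N.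
Proof.
rewrite /dyadic_floor expnSr divnMA.
set k := (n %/ 2 ^ i)%N.
have := divn_eq k 2; have : (k %% 2 < 2)%N by rewrite ltn_mod.
case: (k %% 2)%N => [|[|//]] _ kE; [left|right]; rewrite {1}kE; lia.
Qed.

(** Here [m] consists of the leading [s + 1] binary digits of [n]. For fixed [s] it takes finitely
    many values, whatever the scale [J]. *)
Lemma dyadic_floor_block (s J n : nat) : (s <= J)%N -> (2 ^ J <= n < 2 ^ J.+1)%N ->
  exists m, [/\ (2 ^ s <= m < 2 ^ s.+1)%N & dyadic_floor (J - s) n = (m * 2 ^ (J - s))%N].
Proof.
move=> sJ /andP[n1 n2]; exists (n %/ 2 ^ (J - s))%N; split => //.
rewrite leq_divRL ?expn_gt0 // ltn_divLR ?expn_gt0 // -!expnD subnKC //.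
by rewrite addSn subnKC // n1 n2.
Qed.

Lemma dyadic_floor_le i n : (dyadic_floor i n <= n)%N.
Proof. exact: leq_divM. Qed.

Lemma dyadic_floor_ge i J n : (i <= J)%N -> (2 ^ J <= n)%N -> (2 ^ J <= dyadic_floor i n)%N.
Proof.
move=> iJ Jn; rewrite /dyadic_floor -{1}(subnK iJ) expnD leq_mul2r.
by rewrite leq_divRL ?expn_gt0 // -expnD subnK // Jn orbT.
Qed.

Lemma dyadic_floor_rem i n : (n - dyadic_floor i n < 2 ^ i)%N.
Proof.
rewrite /dyadic_floor {1}(divn_eq n (2 ^ i)) addnC addnK ltn_mod.
by rewrite expn_gt0.
Qed.

(** The distance is abstract and extended-valued because the chain is run twice: with the
    second-moment norm of increments, to regularize [g], and with [|X l w - X k w|] along a path. *)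
Lemma chain_sum {R : realType} (dst : nat -> nat -> \bar R) (n i0 I J : nat)
    (c c' rho : R) :
  (forall k l m, (dst k m <= dst k l + dst l m)%E) ->
  0 < rho < 1 -> 0 <= c -> (i0 <= I <= J)%N ->
  (dst (dyadic_floor i0 n) n <= c'%:E)%E ->
  (forall i, (i0 <= i < I)%N -> (dst (dyadic_floor i.+1 n) (dyadic_floor i n)
     <= (c * (1 - rho) * rho ^+ (J - i))%:E)%E) ->
  (dst (dyadic_floor I n) n <= (c' + c * rho ^+ (J - I))%:E)%E.
Proof.
move=> tri /andP[r0 r1] c0 /andP[iI IJ] h0 hi.
have [m mI] : exists m, I = (i0 + m)%N by exists (I - i0)%N; lia.
subst I.
(* With one more power of [rho] the induction closes exactly, as [(1 - rho) * rho ^ k + rho ^ (k +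
   1) = rho ^ k]. *)
suff : (dst (dyadic_floor (i0 + m) n) n <= (c' + c * rho ^+ (J - (i0 + m)).+1)%:E)%E.
  move/le_trans; apply; rewrite lee_fin lerD2l ler_wpM2l // exprS.
  by rewrite ler_piMl ?exprn_ge0 ?ltW.
elim: m iI IJ hi => [|m IH] _ IJ hi.
  rewrite addn0; apply: (le_trans h0); rewrite lee_fin lerDl mulr_ge0 //.
  by rewrite exprn_ge0 // ltW.
rewrite addnS; apply: le_trans (tri _ (dyadic_floor (i0 + m) n) _) _.
have h1 : (dst (dyadic_floor (i0 + m) n) n <= (c' + c * rho ^+ (J - (i0 + m)).+1)%:E)%E.
  by apply: IH; [lia|lia|move=> i ?; apply: hi; lia].
have h2 := hi (i0 + m)%N ltac:(lia).
apply: le_trans (leeD h2 h1) _; rewrite -EFinD lee_fin.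
have -> : (J - (i0 + m).+1).+1 = (J - (i0 + m))%N by lia.
by rewrite exprS; lra.
Qed.

End dyadic.

(* [lia] after dropping the hypotheses, such as powers of 2, that slow it down. *)
Ltac nlia := repeat match goal with
  | H : ?T |- _ => lazymatch T with
    | context [expn] => clear H
    | nat => fail
    | is_true (leq _ _) => fail
    | is_true (andb (leq _ _) (leq _ _)) => fail
    | @eq nat _ _ => fail
    | _ => clear H
    end
  end; lia.

(** * Eventual statements along dyadic scales *)

Section near_dyadic.

Lemma near_dyadic (Q : nat -> Prop) (s : nat) :
  (\forall n \near \oo, Q n) -> \forall J \near \oo, Q (2 ^ (J - s))%N.
Proof.
move=> [M _ QM]; exists (M + s)%N => //= J /= MJ; apply: QM => /=.
have : (J - s < 2 ^ (J - s))%N by exact: ltn_expl.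
by lia.
Qed.

Lemma near_forall_ltn (n : nat) (Q : nat -> nat -> Prop) :
  (forall m, (m < n)%N -> \forall J \near \oo, Q m J) ->
  \forall J \near \oo, forall m, (m < n)%N -> Q m J.
Proof.
elim: n => [|n IH] h; first by apply: nearW.
have h1 : \forall J \near \oo, forall m, (m < n)%N -> Q m J.
  by apply: IH => m mn; apply: h; lia.
have h2 := h n (ltnSn n).
near=> J => m; rewrite ltnS leq_eqVlt => /predU1P[->|mn].
  by near: J.
by move: m mn; near: J.
Unshelve. all: by end_near. Qed.

Lemma near_window (A : nat -> Prop) :
  (\forall J \near \oo, A J) ->
  \forall n \near \oo, exists2 J, (2 ^ J <= n < 2 ^ J.+1)%N & A J.
Proof.
move=> [M _ AM]; exists (2 ^ M)%N => //= n Mn.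
have n0 : (0 < n)%N by apply: leq_trans Mn; rewrite expn_gt0.
exists (trunc_log 2 n); first exact: trunc_log_bounds.
by apply: AM => /=; apply: trunc_log_max.
Qed.

End near_dyadic.

(** * Regular variation of [g] along fixed integer multiples *)

Section regular_variation.
Context {R : realType} (g : nat -> R) (L : R -> R) (a : R).
Hypothesis g0 : forall n, 0 <= g n.
Hypothesis slowL : slowly_varying L.
Hypothesis a01 : 0 < a <= 1.
Hypothesis gL : asympt_equiv g (fun n => n%:R `^ a * L n%:R).

Let v (n : nat) : R := n%:R `^ a * L n%:R.

Let gv_gt0 : \forall n \near \oo, 0 < g n / v n.
Proof. by apply: (cvgr_gt 1 gL); rewrite ltr01. Qed.

Lemma regular_gt0 : \forall n \near \oo, 0 < g n.
Proof.
near=> n; rewrite lt_neqAle g0 andbT eq_sym; apply/eqP => gn.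
suff : 0 < g n / v n by rewrite gn mul0r ltxx.
by near: n.
Unshelve. all: by end_near. Qed.

Lemma regular_ratio (m : nat) : (0 < m)%N ->
  g (m * n)%N / g n @[n --> \oo] --> m%:R `^ a.
Proof.
move=> m0.
have mR : (0 : R) < m%:R by rewrite ltr0n.
have mny : (fun n => m * n)%N @ \oo --> \oo.
  move=> A [N _ NA]; exists N => //= n Nn; apply: NA => /=.
  by apply: (leq_trans Nn); rewrite leq_pmull.
have c1 : g (m * n)%N / v (m * n)%N @[n --> \oo] --> (1 : R).
  exact: (cvg_comp _ (fun n => g n / v n) mny gL).
have c2 : L (m%:R * n%:R) / L n%:R @[n --> \oo] --> (1 : R).
  exact: (cvg_comp _ (fun x => L (m%:R * x) / L x) cvgr_idn (slowL mR)).
have c3 : (g n / v n)^-1 @[n --> \oo] --> (1^-1 : R).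
  by apply: cvgV => //; rewrite oner_neq0.
have c4 : g (m * n)%N / v (m * n)%N * (m%:R `^ a * (L (m%:R * n%:R) / L n%:R)) *
    (g n / v n)^-1 @[n --> \oo] --> 1 * (m%:R `^ a * 1) * 1^-1.
  by apply: cvgM => //; apply: cvgM => //; apply: cvgM => //; exact: cvg_cst.
rewrite invr1 !mulr1 mul1r in c4.
apply: cvg_trans c4; apply: near_eq_cvg.
have gvm : \forall n \near \oo, 0 < g (m * n)%N / v (m * n)%N.
  exact: (mny _ gv_gt0).
near=> n.
have h1 : 0 < g n / v n by near: n.
have h2 : 0 < g (m * n)%N / v (m * n)%N by near: n.
(* [L] may vanish or be negative; since division by 0 gives 0, positivity of the quotients is what
   makes the denominators nonzero. *)
have vn0 : v n != 0 by apply/eqP => E; move: h1; rewrite E invr0 mulr0 ltxx.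
have gn0 : g n != 0 by apply/eqP => E; move: h1; rewrite E mul0r ltxx.
have vm0 : v (m * n)%N != 0 by apply/eqP => E; move: h2; rewrite E invr0 mulr0 ltxx.
have vE : v (m * n)%N = m%:R `^ a * (L (m%:R * n%:R) / L n%:R) * v n.
  have Ln0 : L n%:R != 0 by apply/eqP => E; move: vn0; rewrite /v E mulr0 eqxx.
  by rewrite /v natrM powRM ?ler0n //; field.
rewrite -[X in _ * X * _](mulfK vn0) -vE.
by field; rewrite vm0 vn0 gn0.
Unshelve. all: by end_near. Qed.

Lemma regular_dyadic_growth : exists (rho : R) (i0 : nat), [/\ 0 < rho < 1,
  forall i, (i0 <= i)%N -> 0 < g (2 ^ i)%N &
  forall i, (i0 <= i)%N -> g (2 ^ i)%N <= rho ^+ 2 * g (2 ^ i.+1)%N].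
Proof.
have /andP[a0 a1] := a01.
(* [rho = 2 ^ (- a / 4)], so that [rho ^ -2 = 2 ^ (a / 2)] lies strictly below the limit [2 ^ a] of
   [g (2 * n) / g n]. *)
pose rho : R := expR (- (a / 4 * ln 2)).
have ln2 : 0 < ln (2 : R) by rewrite ln_gt0 // ltr1n.
have r0 : 0 < rho by exact: expR_gt0.
have r1 : rho < 1 by rewrite expR_lt1 oppr_lt0 mulr_gt0 // divr_gt0.
have E2 : rho ^- 2 < (2 : R) `^ a.
  rewrite -exprVn -expRN opprK expr2 -expRD /powR gt_eqF // ltr_expR.
  by nra.
have c := regular_ratio (isT : (0 < 2)%N).
have h : \forall n \near \oo, rho ^- 2 < g (2 * n)%N / g n /\ 0 < g n.
  have h1 : \forall n \near \oo, rho ^- 2 < g (2 * n)%N / g n by exact: (cvgr_gt _ c).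
  have h2 := regular_gt0.
  by near=> n; split; near: n.
have [i0 _ hi] := near_dyadic 0 h.
exists rho, i0; split => [|i ii|i ii]; first by rewrite r0.
  by have := (hi i ii).2; rewrite subn0.
have [] := hi i ii; rewrite subn0 => h1 h2.
rewrite expnS -ler_pdivrMl ?exprn_gt0 //.
by move: h1; rewrite ltr_pdivlMr // => /ltW.
Unshelve. all: by end_near. Qed.

(** For fixed [s] only finitely many [m] occur, and each ratio tends to [(m / 2 ^ s) ^ a], which
    lies in [[1, 2]] because [0 < a <= 1]. *)
Lemma regular_block (s : nat) (eta : R) : 0 < eta ->
  \forall J \near \oo, forall m, (2 ^ s <= m < 2 ^ s.+1)%N ->
    (1 - eta) * g (2 ^ J)%N <= g (m * 2 ^ (J - s))%N <= (2 + eta) * g (2 ^ J)%N.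
Proof.
move=> e0; have /andP[a0 a1] := a01.
have s0 : (0 : R) < (2 ^ s)%N%:R by rewrite ltr0n expn_gt0.
suff h : \forall n \near \oo, forall m, (m < 2 ^ s.+1)%N -> (2 ^ s <= m)%N ->
    (1 - eta) * g (2 ^ s * n)%N <= g (m * n)%N <= (2 + eta) * g (2 ^ s * n)%N.
  have [M _ hM] := near_dyadic s h.
  exists (M + s)%N => //= J /= MJ m /andP[m1 m2].
  have := hM J ltac:(rewrite /=; nlia) m m2 m1.
  by rewrite -expnD subnKC //; lia.
apply: near_forall_ltn => m ms.
have [sm|] := leqP (2 ^ s)%N m; last by move=> _; apply: nearW.
have m0 : (0 < m)%N by apply: leq_trans sm; rewrite expn_gt0.
have mR : (0 : R) < m%:R by rewrite ltr0n.
have c1 := regular_ratio m0.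
have c2 := @regular_ratio (2 ^ s)%N ltac:(by rewrite expn_gt0).
set l1 := m%:R `^ a in c1; set l2 := (2 ^ s)%N%:R `^ a in c2.
have l20 : 0 < l2 by rewrite powR_gt0.
have c3 : (g (m * n)%N / g n) / (g (2 ^ s * n)%N / g n) @[n --> \oo] --> l1 / l2.
  by apply: cvgM => //; apply: cvgV => //; rewrite gt_eqF.
have l12 : l2 <= l1.
  by apply: ge0_ler_powR; rewrite ?nnegrE ?ler0n ?ler_nat // ltW.
have l11 : l1 <= 2 * l2.
  apply: (@le_trans _ _ ((2 * (2 ^ s)%N%:R) `^ a)).
    apply: ge0_ler_powR; rewrite ?nnegrE ?ler0n ?ltW // ?mulr_ge0 //.
    by rewrite -natrM ltr_nat -expnS.
  by rewrite powRM // ler_pM2r // ler1_powR // ler1n.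
have h1 : 1 - eta < l1 / l2 by rewrite ltr_pdivlMr //; nra.
have h2 : l1 / l2 < 2 + eta by rewrite ltr_pdivrMr //; nra.
have n1 : \forall n \near \oo, 1 - eta < (g (m * n)%N / g n) / (g (2 ^ s * n)%N / g n).
  exact: (cvgr_gt _ c3).
have n2 : \forall n \near \oo, (g (m * n)%N / g n) / (g (2 ^ s * n)%N / g n) < 2 + eta.
  exact: (cvgr_lt _ c3).
have gp := regular_gt0.
have gps : \forall n \near \oo, 0 < g (2 ^ s * n)%N.
  have [N _ hN] := gp; exists N => //= n Nn; apply: hN => /=.
  by apply: (leq_trans Nn); rewrite leq_pmull // expn_gt0.
near=> n => _.
have gn : 0 < g n by near: n.
have gsn : 0 < g (2 ^ s * n)%N by near: n.
have E : (g (m * n)%N / g n) / (g (2 ^ s * n)%N / g n) = g (m * n)%N / g (2 ^ s * n)%N.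
  by field; rewrite ?gt_eqF.
have k1 : 1 - eta < g (m * n)%N / g (2 ^ s * n)%N by rewrite -E; near: n.
have k2 : g (m * n)%N / g (2 ^ s * n)%N < 2 + eta by rewrite -E; near: n.
move: k1 k2; rewrite ltr_pdivlMr // ltr_pdivrMr // => k1 k2.
by rewrite !ltW.
Unshelve. all: by end_near. Qed.

End regular_variation.

(** * Geometric growth of [g] at powers of 2 *)

Section dyadic_growth.
Context {R : realType} (g : nat -> R) (rho : R) (i0 : nat).
Hypothesis g0 : forall n, 0 <= g n.
Hypothesis rho01 : 0 < rho < 1.
Hypothesis gpos : forall i, (i0 <= i)%N -> 0 < g (2 ^ i)%N.
Hypothesis ggrow : forall i, (i0 <= i)%N -> g (2 ^ i)%N <= rho ^+ 2 * g (2 ^ i.+1)%N.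

Lemma dyadic_le i j : (i0 <= i <= j)%N ->
  g (2 ^ i)%N <= rho ^+ (2 * (j - i)) * g (2 ^ j)%N.
Proof using rho01 ggrow.
have /andP[r0 r1] := rho01.
move=> /andP[ii ij]; rewrite -(subnKC ij) addnC; set k := (j - i)%N.
rewrite addnK; elim: k => [|k IH]; first by rewrite mul1r.
apply: (le_trans IH).
rewrite (_ : (2 * k.+1 = 2 * k + 2)%N); last by lia.
rewrite exprD -mulrA.
rewrite (ler_wpM2l (exprn_ge0 _ (ltW r0))) // addSn.
by apply: ggrow; nlia.
Qed.

Lemma expr_small (eps : R) : 0 < eps -> exists s0, forall s, (s0 <= s)%N -> rho ^+ s <= eps.
Proof using rho01.
have /andP[r0 r1] := rho01 => e0.
have c : rho ^+ n @[n --> \oo] --> (0 : R).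
  by apply: cvg_expr; rewrite ger0_norm // ltW.
have [N _ h] : \forall n \near \oo, rho ^+ n < eps by exact: (cvgr_lt _ c).
by exists N => s Ns; apply: ltW; exact: h.
Qed.

Lemma dyadic_dvg (M : R) : \forall J \near \oo, M <= g (2 ^ J)%N.
Proof.
have /andP[r0 r1] := rho01.
have gi : 0 < g (2 ^ i0)%N by exact: gpos.
have M1 : 0 < g (2 ^ i0)%N / (`|M| + 1) by rewrite divr_gt0 // ltr_wpDl.
have [s0 h] := expr_small M1.
exists (i0 + s0)%N => //= J /= sJ.
have h1 := @dyadic_le i0 J ltac:(nlia).
have h2 := h (2 * (J - i0))%N ltac:(nlia).
have gJ : 0 <= g (2 ^ J)%N by exact: g0.
have := le_trans h1 (ler_wpM2r gJ h2).
rewrite mulrAC -[leLHS]mulr1 -mulrA ler_pM2l //.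
rewrite ler_pdivlMr ?ltr_wpDl // mul1r => h3.
by apply: le_trans h3; have := ler_norm M; lra.
Qed.

End dyadic_growth.

(* [L] is not assumed measurable, so the uniform convergence theorem is not
   available: between dyadic points the regularity of [g] comes from the
   triangle inequality for the increment norm [N]. *)
Section norm_regularity.
Context {R : realType} (g : nat -> R) (rho : R) (i0 : nat).
Variables (N : nat -> nat -> \bar R) (K : R).
Hypothesis g0 : forall n, 0 <= g n.
Hypothesis rho01 : 0 < rho < 1.
Hypothesis gpos : forall i, (i0 <= i)%N -> 0 < g (2 ^ i)%N.
Hypothesis ggrow : forall i, (i0 <= i)%N -> g (2 ^ i)%N <= rho ^+ 2 * g (2 ^ i.+1)%N.
Hypothesis gblock : forall (s : nat) (eta : R), 0 < eta ->
  \forall J \near \oo, forall m, (2 ^ s <= m < 2 ^ s.+1)%N ->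
    (1 - eta) * g (2 ^ J)%N <= g (m * 2 ^ (J - s))%N <= (2 + eta) * g (2 ^ J)%N.
Hypothesis N_tri : forall k l m, (N k m <= N k l + N l m)%E.
Hypothesis N_sym : forall k l, N k l = N l k.
Hypothesis N_diag : forall k, N k k = 0%E.
Hypothesis K0 : 0 <= K.
Hypothesis N_le : forall n1 n2, (n1 < n2)%N -> 0 < g (n2 - n1)%N ->
  (N n1 n2 <= (K * g (n2 - n1)%N)%:E)%E.
Hypothesis N_asympt : forall eta : R, 0 < eta ->
  \forall l \near \oo, forall n, (((1 - eta) * g l)%:E <= N n (n + l)%N)%E /\
    (N n (n + l)%N <= ((1 + eta) * g l)%:E)%E.
Hypothesis N_small : forall r, exists M : R, \forall k \near \oo, (N k (k + r)%N <= M%:E)%E.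

Lemma norm_rem_bounded (n : nat) : exists M : R,
  \forall k \near \oo, forall r, (r < n)%N -> (N k (k + r)%N <= M%:E)%E.
Proof.
elim: n => [|n [M hM]]; first by exists 0; apply: nearW.
have [M' hM'] := N_small n.
exists (Num.max M M'); near=> k => r; rewrite ltnS leq_eqVlt => /predU1P[->|rn].
  apply: (@le_trans _ _ M'%:E); first by near: k.
  by rewrite lee_fin le_max lexx orbT.
apply: (@le_trans _ _ M%:E); last by rewrite lee_fin le_max lexx.
by move: r rn; near: k.
Unshelve. all: by end_near. Qed.

(** Links of length at least [2 ^ i0] form a geometric series, small once [s] is large. The last
    piece, shorter than [2 ^ i0], has bounded norm by [N_small] and is negligible because
    [g (2 ^ J)] diverges. *)
Lemma norm_dyadic_floor (eps : R) : 0 < eps -> exists s0, forall s, (s0 <= s)%N ->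
  \forall J \near \oo, forall n, (2 ^ J <= n < 2 ^ J.+1)%N ->
    (N (dyadic_floor (J - s) n) n <= (eps * g (2 ^ J)%N)%:E)%E.
Proof.
move=> e0; have /andP[r0 r1] := rho01.
have r1' : 0 < 1 - rho by lra.
have [M [k0 _ hM]] := norm_rem_bounded (2 ^ i0).
have e1 : 0 < eps / 2 * ((1 - rho) / (K + 1)).
  by rewrite mulr_gt0 ?divr_gt0 // ltr_wpDl.
have [s0 hs] := expr_small rho01 e1.
exists s0 => s ss.
have dv := dyadic_dvg g0 rho01 gpos ggrow (M / (eps / 2)).
near=> J => n nJ.
have sJ : (i0 + s <= J)%N by near: J; exact: nbhs_infty_ge.
have k0J : (k0 <= J)%N by near: J; exact: nbhs_infty_ge.
have MJ : M <= eps / 2 * g (2 ^ J)%N.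
  by rewrite -ler_pdivrMl ?divr_gt0 // mulrC; near: J.
have /andP[nJ1 nJ2] := nJ.
have JJ : (J < 2 ^ J)%N by exact: ltn_expl.
set c := K * g (2 ^ J)%N / (1 - rho).
have c0 : 0 <= c by rewrite divr_ge0 ?mulr_ge0 // ltW.
have h := @chain_sum R N n i0 (J - s)%N J c M rho N_tri rho01 c0 ltac:(nlia).
apply: le_trans (h _ _) _.
- have iJ : (i0 <= J)%N by nlia.
  have hd := leq_trans JJ (dyadic_floor_ge iJ nJ1).
  have hr := dyadic_floor_rem i0 n.
  have hl := dyadic_floor_le i0 n.
  have := hM (dyadic_floor i0 n) ltac:(rewrite /=; nlia) _ hr.
  by rewrite subnKC.
- move=> i /andP[ii iJ].
  have cE : c * (1 - rho) * rho ^+ (J - i) = K * (rho ^+ (J - i) * g (2 ^ J)%N).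
    by rewrite /c divfK ?gt_eqF //; ring.
  rewrite cE.
  have [->|->] := dyadic_floorS i n.
    rewrite N_diag lee_fin mulr_ge0 // mulr_ge0 // exprn_ge0 // ltW //.
  set T1 := dyadic_floor i.+1 n.
  have e2 : (T1 + 2 ^ i - T1 = 2 ^ i)%N by rewrite addKn.
  have := @N_le T1 (T1 + 2 ^ i)%N; rewrite e2 => /(_ _ _)/le_trans; apply.
  + by rewrite -addn1 leq_add2l expn_gt0.
  + exact: gpos.
  rewrite lee_fin ler_wpM2l //.
  apply: (le_trans (dyadic_le rho01 ggrow (i := i) (j := J) ltac:(nlia))).
  rewrite ler_wpM2r // ler_wiXn2l ?ltW //; nlia.
rewrite lee_fin subKn; last by nlia.
have h2 : c * rho ^+ s <= eps / 2 * g (2 ^ J)%N.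
  have hs' := hs s ss.
  have c1 : c * (eps / 2 * ((1 - rho) / (K + 1))) <= eps / 2 * g (2 ^ J)%N.
    have -> : c * (eps / 2 * ((1 - rho) / (K + 1))) =
              eps / 2 * g (2 ^ J)%N * (K / (K + 1)).
      by rewrite /c; field; rewrite ?gt_eqF // ltr_wpDl.
    rewrite ler_piMr ?mulr_ge0 ?divr_ge0 ?(ltW e0) //.
    by rewrite ler_pdivrMr ?ltr_wpDl // mul1r lerDl.
  by apply: le_trans c1; rewrite ler_wpM2l.
by lra.
Unshelve. all: by end_near. Qed.

(** Let [D] be the truncation of [n]. Seen from time 0, [N 0 n] and [N 0 D] agree with [g n] and
    [g D] up to factors near 1, so the smallness of [N D n] passes to [g]. *)
Lemma regular_dyadic_floor (eps : R) : 0 < eps <= 1 -> exists s0, forall s, (s0 <= s)%N ->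
  \forall J \near \oo, forall n, (2 ^ J <= n < 2 ^ J.+1)%N ->
    `|g n - g (dyadic_floor (J - s) n)| <= eps * g (2 ^ J)%N.
Proof.
move=> /andP[e0 e1].
have e4 : 0 < eps / 4 by rewrite divr_gt0.
have [s0 hs] := norm_dyadic_floor e4.
exists s0 => s ss.
have h1 := hs s ss.
have h2 := gblock s (ltr01 : (0 : R) < 1).
have e32 : 0 < eps / 32 by rewrite divr_gt0.
have [l0 _ hl] := N_asympt e32.
near=> J => n nJ.
have sJ : (s + l0 <= J)%N by near: J; exact: nbhs_infty_ge.
have JJ : (J < 2 ^ J)%N by exact: ltn_expl.
have Nn : (N (dyadic_floor (J - s) n) n <= (eps / 4 * g (2 ^ J)%N)%:E)%E.
  by move: n nJ; near: J.
have [m [ms mE]] := @dyadic_floor_block s J n ltac:(nlia) nJ.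
have /andP[_ gm] : (1 - 1) * g (2 ^ J)%N <= g (m * 2 ^ (J - s))%N <= (2 + 1) * g (2 ^ J)%N.
  by move: m ms {mE}; near: J.
rewrite -mE in gm.
have /andP[nJ1 nJ2] := nJ.
have hd := leq_trans JJ (dyadic_floor_ge (leq_subr s J) nJ1).
have nJ3 := leq_trans JJ nJ1.
have [a1 a2] := hl n ltac:(rewrite /=; nlia) 0%N.
have [b1 b2] := hl (dyadic_floor (J - s) n) ltac:(rewrite /=; nlia) 0%N.
rewrite !add0n in a1 a2 b1 b2.
set D := dyadic_floor (J - s) n in Nn gm b1 b2 hd *.
have t1 := le_trans a1 (le_trans (N_tri 0 D n) (leeD b2 Nn)).
have t2 : (((1 - eps / 32) * g D)%:E <= ((1 + eps / 32) * g n)%:E + (eps / 4 * g (2 ^ J)%N)%:E)%E.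
  apply: (le_trans b1 (le_trans (N_tri 0 n D) (leeD a2 _))).
  by rewrite N_sym.
rewrite -EFinD lee_fin in t1; rewrite -EFinD lee_fin in t2.
have G0 := g0 (2 ^ J)%N; have gn0 := g0 n; have gD0 := g0 D.
(* A crude a priori bound: the errors in [t1] and [t2] are relative to [g n] and [g D] and must be
   converted into multiples of [g (2 ^ J)]. *)
have gn14 : g n <= 14 * g (2 ^ J)%N.
  have : eps * g D <= g D by rewrite ler_piMl.
  have : eps * g n <= g n by rewrite ler_piMl.
  have : eps * g (2 ^ J)%N <= g (2 ^ J)%N by rewrite ler_piMl.
  lra.
have e_1 : eps * g n <= eps * (14 * g (2 ^ J)%N) by rewrite ler_wpM2l // ltW.
have e_2 : eps * g D <= eps * ((2 + 1) * g (2 ^ J)%N) by rewrite ler_wpM2l // ltW.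
have e_3 : 0 <= eps * g (2 ^ J)%N by rewrite mulr_ge0 // ltW.
rewrite ler_norml; apply/andP; split; lra.
Unshelve. all: by end_near. Qed.

Lemma regular_window : \forall J \near \oo, forall n, (2 ^ J <= n < 2 ^ J.+1)%N ->
  g (2 ^ J)%N / 2 <= g n <= 4 * g (2 ^ J)%N.
Proof.
have e4 : 0 < (4^-1 : R) <= 1 by apply/andP; split; lra.
have [s0 hs] := regular_dyadic_floor e4.
have h1 := hs s0 (leqnn _).
have e4' : 0 < (4^-1 : R) by lra.
have h2 := gblock s0 e4'.
near=> J => n nJ.
have sJ : (s0 <= J)%N by near: J; exact: nbhs_infty_ge.
have [m [ms mE]] := @dyadic_floor_block s0 J n ltac:(nlia) nJ.
have /andP[gm1 gm] : (1 - 4^-1) * g (2 ^ J)%N <= g (m * 2 ^ (J - s0))%N <= (2 + 4^-1) * g (2 ^ J)%N.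
  by move: m ms {mE}; near: J.
have : `|g n - g (dyadic_floor (J - s0) n)| <= 4^-1 * g (2 ^ J)%N.
  by move: n nJ {mE}; near: J.
rewrite mE ler_norml => /andP[? ?].
have G0 := g0 (2 ^ J)%N.
by apply/andP; split; lra.
Unshelve. all: by end_near. Qed.

(** [N 0 n <= N 0 n' + N n' n] compares [g n] with [g (n - n')] up to the small [g n']. In the lower
    bound this replaces the normalization of an increment by [g] at its right end. *)
Lemma regular_separated (eta : R) : 0 < eta < 1 -> exists2 kap : nat, (0 < kap)%N &
  \forall n' \near \oo, forall n, (kap * n' <= n)%N ->
    [/\ 0 < g n', 0 < g n, g n' <= eta * g n & (1 - eta) * g n <= g (n - n')%N].
Proof.
move=> /andP[e0 e1]; have /andP[r0 r1] := rho01.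
have d0 : 0 < eta / 3 by rewrite divr_gt0.
(* 48 = 6 * 4 * 2: the window bounds lose a factor 4 at [n'] and 2 at [n], and [eta / 6] has to
   remain. *)
have d8 : 0 < eta / 48 by rewrite divr_gt0.
have [t ht] := expr_small rho01 d8.
exists (2 ^ t.+1)%N; first by rewrite expn_gt0.
have [J0 _ hJ] := regular_window.
have [l0 _ hl] := N_asympt d0.
have [M0 _ hM] := near_window (nbhs_infty_ge (J0 + i0)%N).
exists (M0 + l0)%N => //= n' /= Mn' n kn.
have [J' nJ' JJ'] := hM n' ltac:(rewrite /=; nlia).
have t1 : (n' * 2 <= n)%N.
  by apply: leq_trans kn; rewrite mulnC leq_mul2r expnS; apply/orP; right; rewrite -{1}[2%N]muln1 leq_mul2l expn_gt0 orbT.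
have [J nJ JJ] := hM n ltac:(rewrite /=; nlia).
rewrite /= in JJ JJ'.
have /andP[a1 a2] := hJ J' ltac:(rewrite /=; nlia) n' nJ'.
have /andP[b1 b2] := hJ J ltac:(rewrite /=; nlia) n nJ.
have tJ : (J' + t <= J)%N.
  have /andP[c1 c2] := nJ; have /andP[d1 d2] := nJ'.
  have : (2 ^ (t.+1 + J') < 2 ^ J.+1)%N.
    apply: leq_ltn_trans c2; apply: leq_trans kn.
    by rewrite expnD leq_mul2l d1 orbT.
  by rewrite ltn_exp2l // => h; nlia.
have gJ' : 0 < g (2 ^ J')%N by apply: gpos; nlia.
have gJ : 0 < g (2 ^ J)%N by apply: gpos; nlia.
have gn' : 0 < g n' by lra.
have gn : 0 < g n by lra.
have gg : g n' <= eta / 6 * g n.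
  have c1 := @dyadic_le R g rho i0 rho01 ggrow J' J ltac:(nlia).
  have c2 := ht (2 * (J - J'))%N ltac:(nlia).
  have c3 := le_trans c1 (ler_wpM2r (ltW gJ) c2).
  apply: (@le_trans _ _ (4 * (eta / 48 * g (2 ^ J)%N))); first by lra.
  have : eta * (g (2 ^ J)%N / 2) <= eta * g n by rewrite ler_pM2l.
  lra.
split => //; first by have : 0 < eta * g n by [rewrite mulr_gt0|]; lra.
have [p1 _] := hl n ltac:(rewrite /=; nlia) 0%N.
have [_ p2] := hl n' ltac:(rewrite /=; nlia) 0%N.
have [_ p3] := hl (n - n')%N ltac:(rewrite /=; nlia) n'.
rewrite subnKC in p3; last by nlia.
rewrite !add0n in p1 p2.
have := le_trans p1 (le_trans (N_tri 0 n' n) (leeD p2 p3)).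
rewrite -EFinD lee_fin => p4.
have q0 := g0 (n - n')%N.
have [q1|q1] := leP (g n) (g (n - n')%N).
  by apply: le_trans q1; rewrite ler_piMl //; lra.
have q2 : eta * g (n - n')%N <= eta * g n by rewrite ler_wpM2l // ltW.
have q3 : eta * g n' <= eta * (eta / 6 * g n) by rewrite ler_wpM2l // ltW.
have q4 : eta * (eta * g n) <= eta * g n by rewrite ler_piMl ?mulr_ge0 // ltW.
lra.
Qed.

End norm_regularity.

(** * Norms and tails of increments from (A1), (A2), (A3) *)

Lemma limn_esup_lty {R : realType} (u : nat -> \bar R) : (limn_esup u < +oo)%E ->
  exists M : R, \forall k \near \oo, (u k <= M%:E)%E.
Proof.
rewrite /limn_esup limf_esupE => /ereal_inf_lt[_ [V VF <-]] Vlt.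
have [M VM] : exists M : R, (ereal_sup [set u k | k in V] <= M%:E)%E.
  move: Vlt; case: (ereal_sup _) => [r _|//|_]; first by exists r.
  by exists 0; exact: leNye.
exists M; apply: filterS VF => k Vk.
by apply: le_trans VM; apply: ereal_sup_ubound; exists k.
Qed.

Lemma cvg_ln_nat {R : realType} : (ln (n%:R : R)) @[n --> \oo] --> +oo.
Proof.
apply/cvgryPge => A.
have [N _ h] : \forall n \near \oo, expR A <= (n%:R : R).
  by apply: nbhs_infty_ger.
near=> n.
have n1 : expR A <= n%:R.
  by apply: h => /=; near: n; exact: nbhs_infty_ge.
rewrite -ler_expR lnK // posrE (lt_le_trans _ n1) //; exact: expR_gt0.
Unshelve. all: by end_near. Qed.

Section process_norm.
Context {R : realType} (dO : measure_display) (Omega : measurableType dO)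
  (P : probability Omega R) (X : nat -> {RV P >-> R}) (g : nat -> R).

Definition incr_norm (k l : nat) : \bar R :=
  poweR (\int[P]_w ((X l w - X k w) ^+ 2)%:E)%E 2^-1.

Lemma measurable_incr k l : measurable_fun setT (fun w => X l w - X k w).
Proof. by apply: measurable_funB. Qed.

Lemma incr_normE k l :
  incr_norm k l = Lnorm P 2%:E (EFin \o (fun w => X l w - X k w)).
Proof.
rewrite unlock /incr_norm; congr (poweR _ _); apply: eq_integral => w _ /=.
by rewrite powR_mulrn // real_normK // num_real.
Qed.

Lemma incr_norm_tri k l m : (incr_norm k m <= incr_norm k l + incr_norm l m)%E.
Proof.
rewrite !incr_normE.
have -> : EFin \o (fun w => X m w - X k w) =
    EFin \o ((fun w => X l w - X k w) \+ (fun w => X m w - X l w)).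
  by apply/funext => w /=; congr (_%:E); ring.
apply: minkowski_EFin; [exact: measurable_incr|exact: measurable_incr|].
by rewrite ler1n.
Qed.

Lemma incr_norm_sym k l : incr_norm k l = incr_norm l k.
Proof.
rewrite /incr_norm; congr (poweR _ _); apply: eq_integral => w _.
by rewrite -sqrrN opprB.
Qed.

Lemma incr_norm_diag k : incr_norm k k = 0%E.
Proof.
rewrite /incr_norm integral0_eq ?poweR0r ?invr_neq0 //.
by move=> w _; rewrite subrr expr0n.
Qed.

Section second_moment.
Variable C : R.
Hypothesis C0 : 0 < C.
Hypothesis A1 : forall n1 n2 : nat, (n1 < n2)%N ->
     (`| \int[P]_w (((X n2 w - X n1 w) / g (n2 - n1)%N) ^+ 2)%:E - 1 |
       <= (C / (1 + ln (n2 - n1)%N%:R))%:E)%E.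

(** The right side of (A1) is finite, which rules out an infinite second moment; the norm is then a
    real multiple of [g]. *)
Lemma incr_norm_ratio n1 n2 : (n1 < n2)%N -> 0 < g (n2 - n1)%N ->
  exists u : R, [/\ 0 <= u, incr_norm n1 n2 = (u * g (n2 - n1)%N)%:E &
    `|u ^+ 2 - 1| <= C / (1 + ln (n2 - n1)%N%:R)].
Proof.
move=> n12; set l := (n2 - n1)%N => gl.
have := A1 n12; rewrite -/l.
have -> : (\int[P]_w (((X n2 w - X n1 w) / g l) ^+ 2)%:E =
    (\int[P]_w ((X n2 w - X n1 w) ^+ 2)%:E) * (g l ^- 2)%:E)%E.
  rewrite -ge0_integralZr //; last 3 first.
  - by apply/measurable_EFinP; apply: measurable_funX; exact: measurable_incr.
  - by move=> w _; rewrite lee_fin sqr_ge0.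
  - by rewrite lee_fin invr_ge0 sqr_ge0.
  by apply: eq_integral => w _; rewrite -EFinM expr_div_n.
rewrite /incr_norm.
have : (0 <= \int[P]_w ((X n2 w - X n1 w) ^+ 2)%:E)%E.
  by apply: integral_ge0 => w _; rewrite lee_fin sqr_ge0.
case: (\int[P]_w _)%E => [s| |] //; last first.
  move=> _; rewrite gt0_mulye ?lte_fin ?invr_gt0 ?exprn_gt0 //.
rewrite lee_fin => s0; rewrite -EFinM -EFinB abse_EFin lee_fin => h.
exists (Num.sqrt s / g l); split.
- by rewrite divr_ge0 ?sqrtr_ge0 // ltW.
- by rewrite poweR_EFin powR12_sqrt // divfK // gt_eqF.
- by rewrite expr_div_n sqr_sqrtr.
Qed.

Let lnl_ge0 (l : nat) : (0 < l)%N -> 0 <= ln (l%:R : R).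
Proof. by move=> l0; rewrite ln_ge0 // ler1n. Qed.

Lemma incr_norm_le n1 n2 : (n1 < n2)%N -> 0 < g (n2 - n1)%N ->
  (incr_norm n1 n2 <= ((1 + C) * g (n2 - n1)%N)%:E)%E.
Proof.
move=> n12 gl; have [u [u0 -> h]] := incr_norm_ratio n12 gl.
have l0 : 0 <= ln ((n2 - n1)%N%:R : R) by apply: lnl_ge0; lia.
rewrite lee_fin ler_pM2r //.
have h1 : C / (1 + ln (n2 - n1)%N%:R) <= C.
  by rewrite ler_pdivrMr ?ltr_wpDr // ler_peMr ?(ltW C0) //; lra.
have h2 := le_trans h h1.
move: h2; rewrite ler_norml => /andP[_ h3].
have C1 : 1 <= 1 + C by rewrite lerDl ltW.
rewrite -ler_sqr ?nnegrE //; last exact: le_trans ler01 C1.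
apply: (@le_trans _ _ (1 + C)); first by rewrite -lerBlDl.
by rewrite expr2 ler_peMr // (le_trans ler01 C1).
Qed.

Lemma incr_norm_asympt (eta : R) : (\forall n \near \oo, 0 < g n) -> 0 < eta ->
  \forall l \near \oo, forall n, (((1 - eta) * g l)%:E <= incr_norm n (n + l)%N)%E /\
    (incr_norm n (n + l)%N <= ((1 + eta) * g l)%:E)%E.
Proof.
move=> gp e0.
have lnN : \forall l \near \oo, C / eta <= ln (l%:R : R).
  by move/cvgryPge: (@cvg_ln_nat R); exact.
near=> l => n.
have l0 : (0 < l)%N by near: l; exact: nbhs_infty_gt.
have gl : 0 < g l by near: l.
have ll : C / eta <= ln l%:R by near: l.
have n12 : (n < n + l)%N by lia.
have lE : (n + l - n = l)%N by lia.
have := incr_norm_ratio n12; rewrite lE => /(_ gl)[u [u0 -> h]].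
have h1 : C / (1 + ln l%:R) <= eta.
  rewrite ler_pdivrMr ?ltr_wpDr ?lnl_ge0 // mulrDr mulr1.
  by move: ll; rewrite ler_pdivrMr // mulrC => ll; apply: (le_trans ll); rewrite lerDr ltW.
move: (le_trans h h1); rewrite ler_norml => /andP[h2 h3].
rewrite !lee_fin !ler_pM2r //; split; last by nra.
have [|e1] := leP 1 eta; first by lra.
have : (1 - eta) ^+ 2 <= u ^+ 2 by nra.
by rewrite ler_sqr ?nnegrE //; lra.
Unshelve. all: by end_near. Qed.

End second_moment.

Section moments.
Hypothesis A2 : forall n p : nat, (1 <= n)%N -> (1 <= p)%N ->
     (limn_esup (fun k => \int[P]_w ((X (k + n)%N w - X k w) ^+ (2 * p))%:E)
       < +oo)%E.

Lemma incr_norm_small r : exists M : R,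
  \forall k \near \oo, (incr_norm k (k + r)%N <= M%:E)%E.
Proof.
case: r => [|r].
  by exists 0; apply: nearW => k; rewrite addn0 incr_norm_diag.
have [M hM] := limn_esup_lty (A2 (isT : (1 <= r.+1)%N) (isT : (1 <= 1)%N)).
exists (`|M| `^ 2^-1); apply: filterS hM => k; rewrite muln1 => hk.
rewrite /incr_norm -poweR_EFin; apply: gt0_ler_poweR.
- by rewrite invr_ge0.
- by rewrite in_itv /= leey andbT; apply: integral_ge0 => w _; rewrite lee_fin sqr_ge0.
- by rewrite in_itv /= leey andbT lee_fin.
by apply: (le_trans hk); rewrite lee_fin ler_norm.
Qed.

Lemma incr_moment_tail r p : (1 <= p)%N -> exists2 M : R, 0 <= M &
  \forall k \near \oo, forall t : R, 0 < t ->
    (P [set w | t < `|X (k + r)%N w - X k w| ]%R <= (M / t ^+ (2 * p))%:E)%E.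
Proof.
move=> p1; case: r => [|r].
  exists 0 => //; apply: nearW => k t t0; rewrite mul0r.
  have -> : [set w | t < `|X (k + 0)%N w - X k w|] = set0.
    apply/seteqP; split => w //=; rewrite addn0 subrr normr0; lra.
  by rewrite measure0.
have [M hM] := limn_esup_lty (A2 (isT : (1 <= r.+1)%N) p1).
exists `|M| => //; apply: filterS hM => k hk t t0.
have mX := measurable_incr k (k + r.+1).
have mXp : measurable_fun setT (fun w => (X (k + r.+1)%N w - X k w) ^+ (2 * p)).
  exact: measurable_funX.
have X0 w : 0 <= (X (k + r.+1)%N w - X k w) ^+ (2 * p) by rewrite exprM exprn_ge0 // sqr_ge0.
have tp : 0 < t ^+ (2 * p) by rewrite exprn_gt0.
have hk' := le_trans hk (ler_norm M : (M%:E <= `|M|%:E)%E).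
apply: le_trans (markov_ge mXp X0 tp hk').
apply: le_measure; rewrite ?inE.
- by apply: measurable_set_ltr => //; exact: measurableT_comp.
- exact: measurable_set_ler.
move=> w /= h; rewrite exprM [leRHS]exprM -(real_normK (num_real (_ - _))).
by apply: lerXn2r; rewrite ?nnegrE ?sqr_ge0 // lerXn2r ?nnegrE // ltW.
Qed.

End moments.

Section wasserstein_tail.
Variables C lam : R.
Hypothesis C0 : 0 < C.
Hypothesis A3 : forall (dG : measure_display) (TG : measurableType dG)
       (PG : probability TG R) (G : TG -> vec 1),
     std_gauss_vec PG G ->
     forall n1 n2 : nat, (n1 < n2)%N ->
     forall theta : R, 1 <= theta ->
        (wasserstein theta P (fun w (_ : 'I_1) => (X n2 w - X n1 w) / g (n2 - n1)%N)%R PG G <=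
          (C * alphaW theta * theta `^ lam / (1 + ln (n2 - n1)%N%:R))%:E)%E.

Lemma incr_gauss_tail (p : nat) : (2 <= p)%N -> exists2 Cp : R, 0 < Cp &
  forall (n1 n2 : nat) (x y : R), (n1 < n2)%N -> 0 < g (n2 - n1)%N -> 0 <= x -> 0 < y ->
    (P [set w | (x + y) * g (n2 - n1)%N < `|X n2 w - X n1 w| ]%R <=
     (2 * expR (- x ^+ 2 / 2) + (Cp / (1 + ln (n2 - n1)%N%:R) / y) ^+ p)%:E)%E.
Proof.
move=> p2.
have p1R : (1 : R) < p%:R by rewrite ltr1n.
have al : 0 < alphaW (p%:R : R).
  by rewrite /alphaW gt_eqF // sqrtr_gt0 subr_gt0.
(* The factor 2 makes the bound of (A3) strict, as the choice of a coupling requires. *)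
pose Cp := 2 * (C * alphaW p%:R * p%:R `^ lam).
have Cp0 : 0 < Cp by rewrite !mulr_gt0 // powR_gt0 // (lt_trans ltr01).
exists Cp => // n1 n2 x y n12; set l := (n2 - n1)%N => gl x0 y0.
have l0 : 0 <= ln (l%:R : R) by rewrite ln_ge0 // ler1n /l; lia.
have l1 : 0 < 1 + ln (l%:R : R) by lra.
have [dG [TG [PG [G gG]]]] := @std_gauss_vec_exists R 1.
have W := A3 gG n12 (ltW p1R).
have -> : [set w | (x + y) * g l < `|X n2 w - X n1 w|] =
    [set w | x + y < `|(fun w (_ : 'I_1) => (X n2 w - X n1 w) / g l) w ord0| ].
  by apply/seteqP; split => w /=; rewrite normrM normfV (gtr0_norm gl) ltr_pdivlMr.
apply: (@wasserstein_tail R p _ x y _ _ P (fun w (_ : 'I_1) => (X n2 w - X n1 w) / g l) _ _ PG G _ _ x0 y0 gG).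
- by lia.
- by rewrite divr_ge0 ?ltW.
apply: (le_lt_trans W); rewrite lte_fin ltr_pM2r ?invr_gt0 // /Cp.
by rewrite ltr_pMl ?ltr1n // !mulr_gt0 // powR_gt0 // (lt_trans ltr01).
Qed.

End wasserstein_tail.

End process_norm.

(** * Numerical estimates for the levels of the chain *)

Lemma sqrn_le_exp2 m : (m ^ 2 <= 4 * 2 ^ m)%N.
Proof.
elim: m => [|[|[|[|m]]] IH] //; rewrite [(2 ^ m.+4)%N]expnS.
by move: IH; rewrite -!mulnn; set q := (2 ^ m.+3)%N; nia.
Qed.

Section numeric.
Context {R : realType}.

Lemma ln2_ge_half : 2^-1 <= ln (2 : R).
Proof.
have h : ln (1 + - 2^-1 : R) <= - 2^-1 by apply: le_ln1Dx; lra.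
have E : 1 + - 2^-1 = 2^-1 :> R by lra.
by move: h; rewrite E lnV ?posrE // lerN2.
Qed.

Lemma bernoulli_ineq (x : R) n : 0 <= x -> 1 + n%:R * x <= (1 + x) ^+ n.
Proof.
move=> x0; elim: n => [|n IH]; first by rewrite mul0r addr0 expr0.
rewrite exprS -natr1.
have h : (1 + x) * (1 + n%:R * x) <= (1 + x) * (1 + x) ^+ n.
  by rewrite ler_wpM2l // addr_ge0.
apply: le_trans h; have : 0 <= n%:R * x * x by rewrite !mulr_ge0.
lra.
Qed.

Lemma expR1_ge2 : 2 <= expR 1 :> R.
Proof. by have := expR_ge1Dx (1 : R); lra. Qed.

(** By Bernoulli's inequality [rho ^ (-2 j)] grows at least linearly in [j], and a linear gain in
    the exponent already beats the number [2 ^ j] of links geometrically. *)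
Lemma gauss_level (rho : R) : 0 < rho < 1 -> exists2 B : R, 1 <= B &
  forall (j : nat) (l : R), 1 <= l ->
    2 ^+ j * expR (- ((B * rho ^- j) ^+ 2 * l)) <= 2 ^- j * expR (- (2 * l)).
Proof.
move=> /andP[r0 r1].
pose kap := rho ^- 2 - 1.
have k0 : 0 < kap.
  rewrite subr_gt0 invf_gt1 ?exprn_gt0 // expr2.
  by have := ltr_pM2l r0 rho 1; rewrite mulr1 r1 => h; lra.
(* Ensures [B ^+ 2 >= 2] and [B ^+ 2 * kap >= 2], so that the exponent is at least
   [(2 + 2 j) l >= 2 l + 2 j]. *)
pose B := 2 + 2 / kap.
have B2 : 2 <= B by rewrite lerDl divr_ge0 // ltW.
have Bk : 2 <= B ^+ 2 * kap.
  have : 2 <= B * kap by rewrite /B mulrDl divfK ?gt_eqF //; nra.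
  by rewrite expr2 -mulrA; nra.
exists B; first by lra.
move=> j l l1.
have rE : (rho ^- j) ^+ 2 = (1 + kap) ^+ j.
  by rewrite /kap addrC subrK -!exprVn -!exprM mulnC.
have h1 : 2 + 2 * j%:R <= (B * rho ^- j) ^+ 2.
  rewrite exprMn rE.
  have := ler_wpM2l (sqr_ge0 B) (bernoulli_ineq j (ltW k0)).
  apply: le_trans; rewrite mulrDr mulr1 mulrCA.
  have : j%:R * 2 <= j%:R * (B ^+ 2 * kap) by rewrite ler_wpM2l.
  have : 2 <= B ^+ 2 by nra.
  lra.
have h2 : 2 * l + 2 * j%:R <= (B * rho ^- j) ^+ 2 * l.
  have j0 : (0 : R) <= j%:R by [].
  have : (2 + 2 * j%:R) * l <= (B * rho ^- j) ^+ 2 * l by rewrite ler_pM2r //; lra.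
  by apply: le_trans; nra.
have h3 : expR (- ((B * rho ^- j) ^+ 2 * l)) <= expR (- (2 * l)) * (4 ^- j).
  apply: (@le_trans _ _ (expR (- (2 * l)) * expR (- (2 * j%:R)))).
    by rewrite -expRD ler_expR; lra.
  rewrite ler_wpM2l ?expR_ge0 // expRN lef_pV2 ?posrE ?expR_gt0 ?exprn_gt0 //.
  rewrite mulrC expRM_natl -[2]/(1 *+ 2) mulr2n expRD.
  apply: lerXn2r; rewrite ?nnegrE ?mulr_ge0 ?expR_ge0 //.
  by have := expR1_ge2; nra.
apply: (le_trans (ler_wpM2l _ h3)); first by rewrite exprn_ge0.
rewrite mulrCA mulrC ler_wpM2r ?expR_ge0 //.
have -> : (4 : R) = 2 * 2 by rewrite -natrM.
by rewrite exprMn invfM mulrA divff ?mul1r // expf_neq0.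
Qed.

(** Trading [1 + i] for [i + j + 1] costs [2 ^ j], hence [4 ^ j] after squaring. With the [2 ^ j]
    links this makes [8 ^ j], which [rho ^+ p <= 16^-1] turns into [2 ^- j]. Only two of the [p]
    powers of the logarithm are kept. *)
Lemma poly_level (rho Cp t : R) (p i j : nat) : 0 < rho < 1 ->
  rho ^+ p <= 16^-1 -> (2 <= p)%N -> 0 <= Cp -> 1 <= t ->
  2 ^+ j * (Cp / (1 + ln (2 ^ i)%N%:R) / (t * rho ^- j)) ^+ p <=
  4 * Cp ^+ p * 2 ^- j / (i + j).+1%:R ^+ 2.
Proof.
move=> /andP[r0 r1] rp p2 C0 t1.
set A := 1 + ln _.
have AE : A = 1 + i%:R * ln 2 by rewrite /A natrX lnXn // mulr_natl.
have l2 := ln2_ge_half.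
have i0 : (0 : R) <= i%:R by [].
have A1 : 1 <= A by rewrite AE lerDl mulr_ge0 //; lra.
have A2 : (1 + i%:R) / 2 <= A by rewrite AE; nra.
have ij : (i + j).+1%:R <= 2 * 2 ^+ j * A.
  apply: (@le_trans _ _ (2 ^+ j * (1 + i%:R))).
    have : ((i + j).+1 <= 2 ^ j * (1 + i))%N.
      have : (j.+1 <= 2 ^ j)%N by exact: ltn_expl.
      nia.
    by rewrite -(ler_nat R) natrM natrX natrD.
  have : 0 <= (2 : R) ^+ j by rewrite exprn_ge0.
  by nra.
have A0 : 0 < A by lra.
have t0 : 0 < t by lra.
have AV : A ^- p <= 4 * 4 ^+ j / (i + j).+1%:R ^+ 2.
  apply: (@le_trans _ _ (A ^- 2)).
    by rewrite lef_pV2 ?posrE ?exprn_gt0 // ler_weXn2l.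
  rewrite ler_pdivlMr ?exprn_gt0 ?ltr0n // mulrC -ler_pdivlMr ?invr_gt0 ?exprn_gt0 //.
  rewrite invrK.
  have -> : 4 * 4 ^+ j * A ^+ 2 = (2 * 2 ^+ j * A) ^+ 2.
    have -> : (4 : R) = 2 * 2 by rewrite -natrM.
    by rewrite !exprMn -!exprM mulnC exprM expr2 exprMn; ring.
  by apply: lerXn2r; rewrite ?nnegrE ?ler0n // !mulr_ge0 ?exprn_ge0 // ltW.
have E : (Cp / A / (t * rho ^- j)) ^+ p = Cp ^+ p * (A ^- p) * ((rho ^+ p) ^+ j) * t ^- p.
  rewrite invfM invrK !exprMn !exprVn -!exprM (mulnC j p); ring.
rewrite E.
have tV : t ^- p <= 1 by rewrite invf_le1 ?exprn_gt0 // exprn_ege1.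
have rj : (rho ^+ p) ^+ j <= 16^-1 ^+ j.
  by apply: lerXn2r; rewrite ?nnegrE ?exprn_ge0 ?invr_ge0 // ltW.
have Cp0 : 0 <= Cp ^+ p by rewrite exprn_ge0.
have AV0 : 0 <= A ^- p by rewrite invr_ge0 exprn_ge0 // ltW.
apply: (@le_trans _ _ (2 ^+ j * (Cp ^+ p * (4 * 4 ^+ j / (i + j).+1%:R ^+ 2) * 16^-1 ^+ j * 1))).
  rewrite ler_wpM2l ?exprn_ge0 //; apply: ler_pM => //.
  - by rewrite !mulr_ge0 // !exprn_ge0 // ltW.
  - by rewrite invr_ge0 exprn_ge0 // ltW.
  - apply: ler_pM => //; first by rewrite mulr_ge0.
    + by rewrite !exprn_ge0 // ltW.
    + by rewrite ler_wpM2l.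
rewrite mulr1 exprVn.
have -> : (16 : R) = 2 * 2 * (2 * 2) by rewrite -!natrM.
have -> : (4 : R) = 2 * 2 by rewrite -natrM.
rewrite le_eqVlt; apply/orP; left; apply/eqP.
rewrite !exprMn; field.
by rewrite -natrD addrC natr1 pnatr_eq0 expf_neq0.
Qed.

Lemma sum_half_le (J : nat) : \sum_(i < J) (2 : R) ^- (J - i) <= 1.
Proof.
elim: J => [|J IH]; first by rewrite big_ord0.
rewrite big_ord_recr /= subSn // subnn expr1.
have -> : \sum_(i < J) (2 : R) ^- (J.+1 - i) = 2^-1 * \sum_(i < J) 2 ^- (J - i).
  rewrite mulr_sumr; apply: eq_bigr => i _.
  by rewrite subSn ?exprS ?invfM // ltnW.
by lra.
Qed.

Lemma expRn2_ln (x : R) : 0 < x -> expR (- (2 * ln x)) = x ^- 2.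
Proof.
move=> x0; rewrite expRN; congr (_^-1).
by rewrite mulrDl mul1r expRD lnK ?posrE // expr2.
Qed.

End numeric.

(** The function [s] at [2 ^ J], with [ln (2 ^ J)] expanded. *)
Definition dyadic_scale {R : realType} (J : nat) : R :=
  Num.sqrt (2 * ln (J%:R * ln 2)).

Section dyadic_scale.
Context {R : realType}.

Lemma ln_dyadic_dvg (A : R) : \forall J \near \oo, A <= ln (J%:R * ln (2 : R)).
Proof.
have l2 := @ln2_ge_half R.
have [N _ h] : \forall n \near \oo, 2 * expR A <= (n%:R : R) by apply: nbhs_infty_ger.
exists N => //= J /h hJ.
have e0 := expR_gt0 A.
have k : expR A <= J%:R * ln 2.
  apply: (@le_trans _ _ (J%:R * 2^-1)); first by lra.
  by rewrite ler_wpM2l.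
by rewrite -ler_expR lnK // posrE; lra.
Qed.

Lemma dyadic_scaleE (J : nat) : 0 <= ln (J%:R * ln 2 : R) ->
  @dyadic_scale R J ^+ 2 = 2 * ln (J%:R * ln 2).
Proof. by move=> h; rewrite sqr_sqrtr // mulr_ge0. Qed.

Lemma dyadic_scale_ge1 : \forall J \near \oo, 1 <= @dyadic_scale R J.
Proof.
apply: filterS (ln_dyadic_dvg 1) => J h.
by rewrite -[leLHS]sqrtr1 ler_wsqrtr //; lra.
Qed.

End dyadic_scale.

(** * Almost sure chaining along the binary expansion *)

Section chaining.
Context {R : realType} (dO : measure_display) (Omega : measurableType dO)
  (P : probability Omega R) (X : nat -> {RV P >-> R}) (g : nat -> R)
  (rho : R) (i0 : nat).
Hypothesis g0 : forall n, 0 <= g n.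
Hypothesis rho01 : 0 < rho < 1.
Hypothesis gpos : forall i, (i0 <= i)%N -> 0 < g (2 ^ i)%N.
Hypothesis ggrow : forall i, (i0 <= i)%N -> g (2 ^ i)%N <= rho ^+ 2 * g (2 ^ i.+1)%N.
Hypothesis gauss_tail : forall p : nat, (2 <= p)%N -> exists2 Cp : R, 0 < Cp &
  forall (n1 n2 : nat) (x y : R), (n1 < n2)%N -> 0 < g (n2 - n1)%N -> 0 <= x -> 0 < y ->
    (P [set w | (x + y) * g (n2 - n1)%N < `|X n2 w - X n1 w| ]%R <=
     (2 * expR (- x ^+ 2 / 2) + (Cp / (1 + ln (n2 - n1)%N%:R) / y) ^+ p)%:E)%E.
Hypothesis moment_tail : forall r p : nat, (1 <= p)%N -> exists2 M : R, 0 <= M &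
  \forall k \near \oo, forall t : R, 0 < t ->
    (P [set w | t < `|X (k + r)%N w - X k w| ]%R <= (M / t ^+ (2 * p))%:E)%E.

Let ds := @dyadic_scale R.

Let measurable_incr_gt (t : R) k l : measurable [set w | t < `|X l w - X k w| ].
Proof.
apply: measurable_set_ltr => //; apply: measurableT_comp => //.
exact: measurable_incr.
Qed.

(** The links of length [2 ^ i] fill [[0, 2 ^ J.+1)]. The factor 2 comes from using the tail bound
    with [x = y], and the weights [rho ^+ (J - i)] sum geometrically. *)
Definition level_bad (B : R) (J i : nat) : set Omega :=
  [set w | exists2 c, (c < 2 ^ (J.+1 - i))%N &
     2 * B * rho ^+ (J - i) * (g (2 ^ J)%N * ds J) <
       `|X (c * 2 ^ i + 2 ^ i)%N w - X (c * 2 ^ i)%N w| ].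

(* Increments shorter than [2 ^ i0], where [g] may vanish and (A1), (A3) say
   nothing, are controlled by the moments of (A2). *)
Definition rem_bad (J : nat) : set Omega :=
  [set w | exists2 k, (k < 2 ^ J)%N & exists2 r, (r < 2 ^ i0)%N &
     rho ^+ J * g (2 ^ J)%N < `|X (2 ^ J + k + r)%N w - X (2 ^ J + k)%N w| ].

Lemma level_bad_prob : exists B K : R, [/\ 1 <= B, 0 <= K &
  \forall J \near \oo, forall i, (i0 <= i < J)%N ->
    measurable (level_bad B J i) /\
    (P (level_bad B J i) <= (K * 2 ^- (J - i) * expR (- (1 + 1) * ln J%:R))%:E)%E].
Proof.
have /andP[r0 r1] := rho01.
have [B B1 hB] := gauss_level rho01.
have e16 : 0 < (16^-1 : R) by lra.
have [p0 hp0] := expr_small rho01 e16.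
pose p := (p0 + 2)%N.
have p2 : (2 <= p)%N by rewrite /p; lia.
have rp : rho ^+ p <= 16^-1 by apply: hp0; rewrite /p; lia.
have [Cp Cp0 hC] := gauss_tail p2.
(* The outer 2 is there because a level has [2 ^ j.+1] links. In [2 * 4] the 2 counts the Gaussian
   tails and the 4 bounds [(ln 2) ^ -2]; the last term is that of [poly_level]. *)
pose K : R := 2 * (2 * 4 + 4 * Cp ^+ p).
exists B, K; split => //.
  by rewrite mulr_ge0 // addr_ge0 ?mulr_ge0 // exprn_ge0 // ltW.
have ldv := ln_dyadic_dvg (1 : R).
have dv := @dyadic_scale_ge1 R.
near=> J => i /andP[ii iJ].
have J0 : (0 < J)%N by nlia.
have JR : (0 : R) < J%:R by rewrite ltr0n.
have lJ : 1 <= ln (J%:R * ln (2 : R)) by near: J.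
have sJ : 1 <= ds J by near: J.
set j := (J - i)%N.
have gi : 0 < g (2 ^ i)%N by exact: gpos.
have gij : g (2 ^ i)%N <= rho ^+ (2 * j) * g (2 ^ J)%N.
  by apply: (dyadic_le rho01 ggrow); nlia.
(* From [gij], [x * g (2 ^ i)] is at most [B * rho ^+ j * g (2 ^ J) * ds J]: raising the level by
   [rho ^- j] uses up one of the two powers of [rho]. *)
pose x : R := B * ds J * rho ^- j.
have rj0 : 0 < rho ^+ j by rewrite exprn_gt0.
have x0 : 0 < x by rewrite !mulr_gt0 ?invr_gt0 //; lra.
pose b : R := 2 * expR (- x ^+ 2 / 2) + (Cp / (1 + ln (2 ^ i)%N%:R) / x) ^+ p.
have inc (c : nat) :
  (P [set w | 2 * B * rho ^+ j * (g (2 ^ J)%N * ds J) <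
       `|X (c * 2 ^ i + 2 ^ i)%N w - X (c * 2 ^ i)%N w| ]%R <= b%:E)%E.
  set n1 := (c * 2 ^ i)%N; set n2 := (n1 + 2 ^ i)%N.
  have nE : (n2 - n1 = 2 ^ i)%N by rewrite /n2 addKn.
  have n12 : (n1 < n2)%N by rewrite /n2 -addn1 leq_add2l expn_gt0.
  have := hC n1 n2 x x n12; rewrite nE => /(_ gi (ltW x0) x0).
  apply: le_trans; apply: le_measure; rewrite ?inE //; try exact: measurable_incr_gt.
  move=> w /=; apply: le_lt_trans.
  have -> : (x + x) * g (2 ^ i)%N = 2 * x * g (2 ^ i)%N by ring.
  apply: (@le_trans _ _ (2 * x * (rho ^+ (2 * j) * g (2 ^ J)%N))).
    by rewrite ler_wpM2l // mulr_ge0 // ltW.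
  rewrite mul2n -addnn exprD /x le_eqVlt; apply/orP; left; apply/eqP.
  by field; rewrite gt_eqF.
have lnE : expR (- (1 + 1) * ln J%:R) = J%:R ^- 2 :> R.
  by rewrite mulNr expRn2_ln.
have l2 := @ln2_ge_half R.
have g1 : 2 ^+ j * expR (- x ^+ 2 / 2) <= 4 * (2 ^- j * J%:R ^- 2).
  have -> : - x ^+ 2 / 2 = - ((B * rho ^- j) ^+ 2 * ln (J%:R * ln 2)).
    rewrite /x mulrAC exprMn [ds J ^+ 2]dyadic_scaleE; last by lra.
    by field; rewrite gt_eqF.
  apply: (le_trans (hB j _ lJ)).
  rewrite expRn2_ln; last by rewrite mulr_gt0 //; lra.
  rewrite exprMn invfM [leRHS]mulrCA ler_wpM2l ?invr_ge0 ?exprn_ge0 //.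
  rewrite mulrC ler_wpM2r ?invr_ge0 ?exprn_ge0 //.
  have -> : (4 : R) = ((2^-1) ^+ 2)^-1 by field.
  rewrite lef_pV2 ?posrE ?exprn_gt0 //; last by lra.
  by apply: lerXn2r; rewrite ?nnegrE //; lra.
have g2 : 2 ^+ j * (Cp / (1 + ln (2 ^ i)%N%:R) / x) ^+ p <= 4 * Cp ^+ p * (2 ^- j * J%:R ^- 2).
  apply: (@le_trans _ _ (4 * Cp ^+ p * 2 ^- j / (i + j).+1%:R ^+ 2)).
    by apply: poly_level => //; [exact: ltW|rewrite mulr_ege1].
  rewrite -mulrA ler_wpM2l ?mulr_ge0 ?exprn_ge0 ?(ltW Cp0) //.
  rewrite ler_wpM2l ?invr_ge0 ?exprn_ge0 //.
  rewrite lef_pV2 ?posrE ?exprn_gt0 ?ltr0n //.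
  apply: lerXn2r; rewrite ?nnegrE // ler_nat /j; nlia.
have [m1 m2] := @union_bound _ _ _ P (2 ^ (J.+1 - i))%N
  (fun c => [set w | 2 * B * rho ^+ j * (g (2 ^ J)%N * ds J) <
       `|X (c * 2 ^ i + 2 ^ i)%N w - X (c * 2 ^ i)%N w| ]) (fun=> b)
  (fun c _ => measurable_incr_gt _ _ _) (fun c _ => inc c).
split => //; apply: (le_trans m2).
have -> : \sum_(c < 2 ^ (J.+1 - i)) b = 2 ^+ (J.+1 - i) * b.
  by rewrite sumr_const card_ord -natrX mulr_natl.
rewrite lee_fin lnE.
have -> : (J.+1 - i = j.+1)%N by rewrite /j subSn // ltnW.
rewrite exprS -[leLHS]mulrA /b mulrDr.
have -> : K * 2 ^- j * J%:R ^- 2 = 2 * (2 * (4 * (2 ^- j * J%:R ^- 2)) + 4 * Cp ^+ p * (2 ^- j * J%:R ^- 2)).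
  by rewrite /K; ring.
rewrite ler_wpM2l //.
apply: lerD; last exact: g2.
by rewrite mulrCA ler_wpM2l.
Unshelve. all: by end_near. Qed.

(** As [g] gains [rho ^- 2] per scale, the threshold is still at least of order [rho ^- J]. A moment
    of order [2 * p] with [rho ^+ (2 * p) <= 4^-1] then gives [4 ^- J] per event, against [2 ^ J]
    positions. *)
Lemma rem_bad_prob : exists2 K : R, 0 <= K &
  \forall J \near \oo, measurable (rem_bad J) /\
    (P (rem_bad J) <= (K * expR (- (1 + 1) * ln J%:R))%:E)%E.
Proof.
have /andP[r0 r1] := rho01.
have e4 : 0 < (4^-1 : R) by lra.
have [p0 hp0] := expr_small rho01 e4.
pose p := p0.+1.
have rp : rho ^+ (2 * p) <= 4^-1 by apply: hp0; rewrite /p; lia.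
have [M [M0 hM]] : exists M : R, 0 <= M /\ \forall k \near \oo, forall r, (r < 2 ^ i0)%N ->
   forall t : R, 0 < t -> (P [set w | t < `|X (k + r)%N w - X k w| ]%R <= (M / t ^+ (2 * p))%:E)%E.
  elim: (2 ^ i0)%N => [|n [M [M0 hM]]]; first by exists 0; split => //; apply: nearW.
  have [M' M'0 hM'] := moment_tail n (isT : (1 <= p)%N).
  exists (M + M'); split; first exact: addr_ge0.
  near=> k => r; rewrite ltnS leq_eqVlt => /predU1P[->|rn] t t0.
    apply: (@le_trans _ _ (M' / t ^+ (2 * p))%:E).
      by move: t t0; near: k.
    by rewrite lee_fin ler_pM2r ?invr_gt0 ?exprn_gt0 // lerDr.
  apply: (@le_trans _ _ (M / t ^+ (2 * p))%:E).
    by move: r rn t t0; near: k.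
  by rewrite lee_fin ler_pM2r ?invr_gt0 ?exprn_gt0 // lerDl.
have gi : 0 < g (2 ^ i0)%N by exact: gpos.
pose c : R := rho ^+ (2 * i0) * g (2 ^ i0)%N.
have c0 : 0 < c by rewrite mulr_gt0 // exprn_gt0.
(* The final 4 comes from [J ^ 2 <= 4 * 2 ^ J], which turns [2 ^- J] into [J ^- 2]. *)
pose K : R := (2 ^ i0)%N%:R * (M / c ^+ (2 * p)) * 4.
exists K.
  by rewrite !mulr_ge0 // invr_ge0 exprn_ge0 // ltW.
near=> J.
have iJ : (i0 <= J)%N by near: J; exact: nbhs_infty_ge.
have J0 : (0 < J)%N by near: J; exact: nbhs_infty_gt.
have JR : (0 : R) < J%:R by rewrite ltr0n.
have rJ : 0 < rho ^+ J by rewrite exprn_gt0.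
have gJ : 0 < g (2 ^ J)%N by exact: gpos.
have tJ : c / rho ^+ J <= rho ^+ J * g (2 ^ J)%N.
  rewrite ler_pdivrMr // mulrAC -expr2 -exprM.
  have := dyadic_le rho01 ggrow (i := i0) (j := J) ltac:(nlia).
  move=> /(ler_wpM2l (exprn_ge0 (2 * i0) (ltW r0))); rewrite mulrA -exprD.
  by rewrite -mulnDr subnKC // (mulnC J).
have t0 : 0 < rho ^+ J * g (2 ^ J)%N by rewrite mulr_gt0.
have hk k r : (r < 2 ^ i0)%N -> (P [set w | rho ^+ J * g (2 ^ J)%N < `|X (2 ^ J + k + r)%N w - X (2 ^ J + k)%N w| ]%R
   <= (M / c ^+ (2 * p) * 4 ^- J)%:E)%E.
  move=> rn.
  have h : forall k r, (r < 2 ^ i0)%N -> forall t : R, 0 < t ->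
     (P [set w | t < `|X (2 ^ J + k + r)%N w - X (2 ^ J + k)%N w| ]%R <= (M / t ^+ (2 * p))%:E)%E.
    near: J; have [N _ hN] := hM; exists N => //= J NJ k' r' rn'; apply: hN => //=.
    by apply: (leq_trans NJ); apply: (leq_trans (ltnW (ltn_expl J (isT : (1 < 2)%N)))); rewrite leq_addr.
  apply: (le_trans (h k r rn _ t0)); rewrite lee_fin -mulrA ler_wpM2l //.
  have cr : 0 < c / rho ^+ J by rewrite divr_gt0.
  apply: (@le_trans _ _ ((c / rho ^+ J) ^- (2 * p))).
    rewrite lef_pV2 ?posrE ?exprn_gt0 //; apply: lerXn2r => //; rewrite nnegrE ltW //.
  rewrite expr_div_n invfM invrK ler_wpM2l ?invr_ge0 ?exprn_ge0 ?(ltW c0) //.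
  rewrite -exprM mulnC exprM -exprVn; apply: lerXn2r => //; rewrite nnegrE ?invr_ge0 // exprn_ge0 // ltW //.
have inner k := @union_bound _ _ _ P (2 ^ i0)%N
  (fun r => [set w | rho ^+ J * g (2 ^ J)%N < `|X (2 ^ J + k + r)%N w - X (2 ^ J + k)%N w| ])
  (fun=> M / c ^+ (2 * p) * 4 ^- J) (fun r _ => measurable_incr_gt _ _ _) (hk k).
have [m1 m2] := @union_bound _ _ _ P (2 ^ J)%N
  (fun k => [set w | exists2 r, (r < 2 ^ i0)%N & rho ^+ J * g (2 ^ J)%N < `|X (2 ^ J + k + r)%N w - X (2 ^ J + k)%N w| ])
  (fun=> _) (fun k _ => (inner k).1) (fun k _ => (inner k).2).
split => //; apply: (le_trans m2).
set b0 := M / c ^+ (2 * p) * 4 ^- J.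
have -> : \sum_(k < 2 ^ J) \sum_(r < 2 ^ i0) b0 = 2 ^+ J * ((2 ^ i0)%N%:R * b0).
  by rewrite !sumr_const !card_ord -natrX !mulr_natl.
rewrite lee_fin mulNr expRn2_ln // /b0.
have -> : 2 ^+ J * ((2 ^ i0)%N%:R * (M / c ^+ (2 * p) * 4 ^- J)) =
    (2 ^ i0)%N%:R * (M / c ^+ (2 * p)) * (2 ^+ J * 4 ^- J) by ring.
rewrite /K -[leRHS]mulrA ler_wpM2l ?mulr_ge0 ?invr_ge0 ?exprn_ge0 ?(ltW c0) //.
have -> : (4 : R) ^- J = 2 ^- J * 2 ^- J.
  by have -> : (4 : R) = 2 * 2 by [rewrite -natrM|]; rewrite exprMn invfM.
rewrite mulrA divff ?mul1r ?expf_neq0 // ler_pdivlMr ?exprn_gt0 // mulrC.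
rewrite ler_pdivrMr ?exprn_gt0 // -natrX -[4]/(4%:R) -natrX -natrM ler_nat.
exact: sqrn_le_exp2.
Unshelve. all: by end_near. Qed.

(** One exceptional null set serves all truncation levels [I], so the number of digits kept can be
    chosen afterwards. *)
Lemma chaining : exists2 D : R, 0 < D & {ae P, forall w, \forall J \near \oo,
  forall n I, (2 ^ J <= n < 2 ^ J.+1)%N -> (i0 <= I <= J)%N ->
  `|X n w - X (dyadic_floor I n) w| <= D * rho ^+ (J - I) * (g (2 ^ J)%N * ds J)}.
Proof.
have /andP[r0 r1] := rho01.
have r1' : 0 < 1 - rho by lra.
have [B [K [B1 K0 [J1 _ hlev]]]] := level_bad_prob.
have [K' K'0 [J2 _ hrem]] := rem_bad_prob.
(* Levels below [i0] are made empty so that the union bound can run over all [i < J]. *)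
pose lev J i := if (i0 <= i)%N then level_bad B J i else set0.
pose A J := if (J1 + J2 <= J)%N then
   [set w | exists2 i, (i < J)%N & lev J i w] `|` rem_bad J else set0.
have levP J : (J1 <= J)%N -> measurable [set w | exists2 i, (i < J)%N & lev J i w] /\
   (P [set w | exists2 i, (i < J)%N & lev J i w] <= (K * expR (- (1 + 1) * ln J%:R))%:E)%E.
  move=> J1J.
  have [m1 m2] := @union_bound _ _ _ P J (lev J)
    (fun i => K * 2 ^- (J - i) * expR (- (1 + 1) * ln J%:R))
    ltac:(move=> i iJ; rewrite /lev; case: ifP => // ii; apply: (hlev J J1J i _).1; by rewrite ii)
    ltac:(move=> i iJ; rewrite /lev; case: ifP => ii;
      [apply: (hlev J J1J i _).2; by rewrite ii
      |by rewrite measure0 lee_fin !mulr_ge0 ?expR_ge0 // invr_ge0 exprn_ge0]).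
  split => //; apply: (le_trans m2); rewrite lee_fin -mulr_suml ler_wpM2r ?expR_ge0 //.
  by rewrite -mulr_sumr ler_piMr //; exact: sum_half_le.
(* The first term sums the links; the 1 absorbs the remainder, as [rho ^+ J <= rho ^+ (J - I)] and
   [ds J >= 1]. *)
exists (2 * B / (1 - rho) + 1).
  by rewrite addr_gt0 // divr_gt0 // mulr_gt0 //; lra.
have mA J : measurable (A J).
  rewrite /A; case: ifP => // JJ; apply: measurableU; first by apply: (levP J _).1; lia.
  by apply: (hrem J _).1 => /=; lia.
have PA : \forall J \near \oo, (P (A J) <= ((K + K') * expR (- (1 + 1) * ln J%:R))%:E)%E.
  exists (J1 + J2)%N => //= J /= JJ; rewrite /A JJ mulrDl EFinD.
  have l := levP J ltac:(lia); have r := hrem J ltac:(rewrite /=; lia).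
  apply: (le_trans (measureU2 _ l.1 r.1)).
  exact: leeD l.2 r.2.
have := borel_cantelli_power mA ltr01 PA.
apply: filterS => w hw.
have dv := @dyadic_scale_ge1 R.
near=> J => n I /andP[nJ1 nJ2] IJ.
have JJ : (J1 + J2 <= J)%N by near: J; exact: nbhs_infty_ge.
have sJ : 1 <= ds J by near: J.
have : ~ A J w by near: J.
rewrite /A JJ => /not_orP[nlev nrem].
have gJ : 0 < g (2 ^ J)%N by apply: gpos; nlia.
have G0 : 0 <= g (2 ^ J)%N * ds J by rewrite mulr_ge0 //; lra.
pose c := 2 * B / (1 - rho) * (g (2 ^ J)%N * ds J).
pose c' := rho ^+ J * g (2 ^ J)%N.
have c0 : 0 <= c by rewrite mulr_ge0 // divr_ge0 ?mulr_ge0 ?(ltW r1') //; lra.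
pose dst k l : \bar R := `|X l w - X k w|%:E.
have tri k l m : (dst k m <= dst k l + dst l m)%E.
  by rewrite /dst -EFinD lee_fin [leRHS]addrC; exact: ler_distD.
have h := @chain_sum R dst n i0 I J c c' rho tri rho01 c0 IJ.
suff : (dst (dyadic_floor I n) n <= (c' + c * rho ^+ (J - I))%:E)%E.
  rewrite /dst lee_fin => /le_trans; apply.
  rewrite /c /c'.
  have h1 : rho ^+ J * g (2 ^ J)%N <= rho ^+ (J - I) * (g (2 ^ J)%N * ds J).
    apply: ler_pM; rewrite ?exprn_ge0 ?(ltW r0) ?(ltW gJ) //.
    - by rewrite ler_wiXn2l ?(ltW r0) ?(ltW r1) // leq_subr.
    - by rewrite ler_peMr // ltW.
  apply: (le_trans (lerD h1 (lexx _))); rewrite le_eqVlt; apply/orP; left; apply/eqP; ring.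
apply: h.
- rewrite /dst lee_fin leNgt; apply/negP => hn; apply: nrem.
  have iJ : (i0 <= J)%N by nlia.
  have hd := dyadic_floor_ge iJ nJ1.
  have hr := dyadic_floor_rem i0 n.
  have hl := dyadic_floor_le i0 n.
  exists (dyadic_floor i0 n - 2 ^ J)%N.
    rewrite ltn_subLR //; apply: (leq_ltn_trans hl).
    by rewrite addnn -mul2n -expnS.
  exists (n - dyadic_floor i0 n)%N => //.
  by rewrite subnKC // subnKC.
- move=> i /andP[ii iI]; rewrite /dst lee_fin.
  have -> : c * (1 - rho) * rho ^+ (J - i) = 2 * B * rho ^+ (J - i) * (g (2 ^ J)%N * ds J).
    by rewrite /c; field; rewrite gt_eqF.
  have [->|E] := dyadic_floorS i n.
    rewrite subrr normr0 !mulr_ge0 ?exprn_ge0 ?(ltW r0) //; lra.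
  rewrite leNgt; apply/negP => hn; apply: nlev.
  exists i; first by nlia.
  have cE : (n %/ 2 ^ i.+1 * 2 * 2 ^ i = dyadic_floor i.+1 n)%N.
    by rewrite /dyadic_floor -mulnA -expnS.
  rewrite /lev ii; exists (n %/ 2 ^ i.+1 * 2)%N.
    rewrite -(ltn_pmul2r (expn_gt0 2 i)) cE -expnD subnK; last by nlia.
    exact: leq_ltn_trans (dyadic_floor_le _ _) nJ2.
  by rewrite cE -E.
Unshelve. all: by end_near. Qed.

End chaining.

Definition lil_scale {R : realType} (n : nat) : R := Num.sqrt (2 * ln (ln n%:R)).

Section lil_scale.
Context {R : realType}.

Lemma dyadic_scale_le (J n : nat) : (0 < J)%N -> (2 ^ J <= n)%N ->
  @dyadic_scale R J <= lil_scale n.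
Proof.
move=> J0 Jn; apply: ler_wsqrtr; rewrite ler_pM2l //.
have l2 := @ln2_ge_half R.
have J2 : 0 < J%:R * ln 2 :> R by rewrite mulr_gt0 ?ltr0n //; lra.
have n0 : (0 < n)%N by apply: leq_trans Jn; rewrite expn_gt0.
have h : J%:R * ln 2 <= ln n%:R :> R.
  rewrite mulr_natl -lnXn // ler_ln ?posrE ?exprn_gt0 ?ltr0n //.
  by rewrite -natrX ler_nat.
by rewrite ler_ln ?posrE //; exact: lt_le_trans h.
Qed.

Lemma lil_scale_mono (m n : nat) : (3 <= m)%N -> (m <= n)%N ->
  @lil_scale R m <= lil_scale n.
Proof.
move=> m3 mn; apply: ler_wsqrtr; rewrite ler_pM2l //.
have lm : 0 < ln (m%:R : R) by rewrite ln_gt0 // ltr1n; lia.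
have h : ln m%:R <= ln n%:R :> R by rewrite ler_ln ?posrE ?ltr0n ?ler_nat //; lia.
by rewrite ler_ln ?posrE //; exact: lt_le_trans h.
Qed.

Lemma ln_ln_dvg (A : R) : \forall n \near \oo, A <= ln (ln (n%:R : R)).
Proof.
have h : \forall n \near \oo, expR A <= ln (n%:R : R).
  by move/cvgryPge: (@cvg_ln_nat R); exact.
apply: filterS h => n h.
by rewrite -ler_expR lnK // posrE (lt_le_trans _ h) // expR_gt0.
Qed.

Lemma lil_scale_ge1 : \forall n \near \oo, 1 <= @lil_scale R n.
Proof.
apply: filterS (ln_ln_dvg 1) => n h.
by rewrite -[leLHS]sqrtr1 ler_wsqrtr //; lra.
Qed.

End lil_scale.

(** * The upper bound *)

Section upper.
Context {R : realType} (dO : measure_display) (Omega : measurableType dO)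
  (P : probability Omega R) (X : nat -> {RV P >-> R}) (g : nat -> R)
  (rho : R) (i0 : nat) (D : R).
Hypothesis X0 : forall w, X 0%N w = 0.
Hypothesis g0 : forall n, 0 <= g n.
Hypothesis rho01 : 0 < rho < 1.
Hypothesis g_gt0 : \forall n \near \oo, 0 < g n.
Hypothesis gauss_tail : forall p : nat, (2 <= p)%N -> exists2 Cp : R, 0 < Cp &
  forall (n1 n2 : nat) (x y : R), (n1 < n2)%N -> 0 < g (n2 - n1)%N -> 0 <= x -> 0 < y ->
    (P [set w | (x + y) * g (n2 - n1)%N < `|X n2 w - X n1 w| ]%R <=
     (2 * expR (- x ^+ 2 / 2) + (Cp / (1 + ln (n2 - n1)%N%:R) / y) ^+ p)%:E)%E.
Hypothesis g_floor : forall eps : R, 0 < eps <= 1 -> exists s0, forall s, (s0 <= s)%N ->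
  \forall J \near \oo, forall n, (2 ^ J <= n < 2 ^ J.+1)%N ->
    `|g n - g (dyadic_floor (J - s) n)| <= eps * g (2 ^ J)%N.
Hypothesis g_window : \forall J \near \oo, forall n, (2 ^ J <= n < 2 ^ J.+1)%N ->
  g (2 ^ J)%N / 2 <= g n <= 4 * g (2 ^ J)%N.
Hypothesis D0 : 0 < D.
Hypothesis X_chain : {ae P, forall w, \forall J \near \oo,
  forall n I, (2 ^ J <= n < 2 ^ J.+1)%N -> (i0 <= I <= J)%N ->
  `|X n w - X (dyadic_floor I n) w| <=
    D * rho ^+ (J - I) * (g (2 ^ J)%N * dyadic_scale J)}.

Lemma block_upper (eps : R) (s : nat) : 0 < eps <= 1 ->
  {ae P, forall w, \forall J \near \oo, forall m, (2 ^ s <= m < 2 ^ s.+1)%N ->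
    `|X (m * 2 ^ (J - s))%N w| <=
      (1 + eps) * g (m * 2 ^ (J - s))%N * dyadic_scale J}.
Proof.
move=> /andP[e0 e1].
have [Cp Cp0 hC] := gauss_tail (isT : (2 <= 2)%N).
have [n0 _ hg] := g_gt0.
have [J1 _ hs] := @dyadic_scale_ge1 R.
have [J2 _ hl] := ln_dyadic_dvg (0 : R).
pose J3 := (n0 + J1 + J2 + s).+1.
pose B J m := if (2 ^ s <= m)%N && (J3 <= J)%N then
  [set w | (1 + eps) * g (m * 2 ^ (J - s))%N * dyadic_scale J <
     `|X (m * 2 ^ (J - s))%N w| ] else set0.
pose A J := [set w | exists2 m, (m < 2 ^ s.+1)%N & B J m w].
(* [expR 2] pays for [ln (J ln 2) >= ln J - 1] multiplied by [1 + eps <= 2]. The 4 combines the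
   halves in [J / 2 <= 1 + ln N] and [eps / 2]. *)
pose K : R := 2 * expR 2 + (4 * Cp / eps) ^+ 2.
have mB J m : measurable (B J m).
  rewrite /B; case: ifP => // _; apply: measurable_set_ltr => //.
  exact: measurableT_comp.
have PB J m : (J3 <= J)%N -> (P (B J m) <= (K * expR (- (1 + eps) * ln J%:R))%:E)%E.
  move=> JJ; rewrite /B JJ andbT.
  have E0 := expR_gt0 (- (1 + eps) * ln J%:R : R).
  have K0 : 0 <= K by apply: addr_ge0; [rewrite mulr_ge0 ?expR_ge0|exact: sqr_ge0].
  have JJ' : ((n0 + J1 + J2 + s).+1 <= J)%N by exact: JJ.
  case: ifP => [sm|_]; last by rewrite measure0 lee_fin mulr_ge0 // ltW.
  have J0 : (0 < J)%N by nlia.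
  have JR : (0 : R) < J%:R by rewrite ltr0n.
  have sJ : (s <= J)%N by nlia.
  set N := (m * 2 ^ (J - s))%N.
  have JN : (2 ^ J <= N)%N.
    by rewrite /N -{1}(subnKC sJ) expnD leq_mul2r sm orbT.
  have JN' : (J < N)%N by apply: leq_trans JN; exact: ltn_expl.
  have gN : 0 < g N by apply: hg => /=; nlia.
  have d1 : 1 <= dyadic_scale J :> R by apply: hs => /=; nlia.
  have l0 : 0 <= ln (J%:R * ln 2) :> R by apply: hl => /=; nlia.
  have l2 := @ln2_ge_half R.
  pose x : R := (1 + eps / 2) * dyadic_scale J.
  pose y : R := eps / 2 * dyadic_scale J.
  have x0 : 0 <= x by rewrite mulr_ge0 //; lra.
  have y0 : 0 < y by rewrite mulr_gt0 ?divr_gt0 //; lra.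
  have := hC 0%N N x y; rewrite subn0 => /(_ ltac:(nlia) gN x0 y0) h.
  apply: (@le_trans _ _ (P [set w | (x + y) * g N < `|X N w - X 0 w| ]%R)).
    rewrite le_eqVlt; apply/orP; left; apply/eqP; congr (P _).
    apply/seteqP; split => w /=; rewrite X0 subr0; congr (_ < _); rewrite /x /y; lra.
  apply: (le_trans h); rewrite lee_fin /K [leRHS]mulrDl; apply: lerD.
    rewrite -mulrA ler_pM2l // -expRD ler_expR.
    have -> : - x ^+ 2 / 2 = - ((1 + eps / 2) ^+ 2 * ln (J%:R * ln 2)).
      by rewrite /x exprMn dyadic_scaleE //; field.
    have h1 : (1 + eps) * ln (J%:R * ln 2) <= (1 + eps / 2) ^+ 2 * ln (J%:R * ln 2).
      by rewrite ler_wpM2r //; nra.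
    have h2 : ln (J%:R) - 1 <= ln (J%:R * ln 2) :> R.
      rewrite lnM ?posrE //; last by lra.
      rewrite lerD2l.
      have h3 : ln (2^-1) <= ln (ln 2) :> R by rewrite ler_ln ?posrE //; lra.
      apply: le_trans h3; rewrite lnV ?posrE // lerN2.
      by have := @le_ln1Dx R 1 ltac:(lra); rewrite -[1 + 1]/(2%:R).
    have h4 : (1 + eps) * (ln J%:R - 1) <= (1 + eps) * ln (J%:R * ln 2).
      by rewrite ler_wpM2l //; lra.
    lra.
  have -> : expR (- (1 + eps) * ln J%:R) = expR (- (2 * ln J%:R)) * expR ((1 - eps) * ln J%:R) :> R.
    by rewrite -expRD; congr expR; ring.
  have lJ0 : 0 <= ln J%:R :> R by rewrite ln_ge0 // ler1n.
  have ge1 : 1 <= expR ((1 - eps) * ln J%:R) :> R.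
    by rewrite -[leLHS]expR0 ler_expR mulr_ge0 // subr_ge0.
  apply: (@le_trans _ _ ((4 * Cp / eps) ^+ 2 * expR (- (2 * ln J%:R)))); last first.
    by rewrite ler_wpM2l ?sqr_ge0 // ler_peMr // expR_ge0.
  rewrite expRn2_ln // -expr_div_n.
  have lN : J%:R / 2 <= 1 + ln N%:R :> R.
    have h1 : J%:R * ln 2 <= ln N%:R :> R.
      rewrite mulr_natl -lnXn // ler_ln ?posrE ?exprn_gt0 ?ltr0n //; last by nlia.
      by rewrite -natrX ler_nat.
    have h2 : J%:R * 2^-1 <= J%:R * ln 2 :> R by rewrite ler_wpM2l.
    lra.
  have lN0 : 0 < 1 + ln N%:R :> R by apply: lt_le_trans lN; rewrite divr_gt0.
  apply: lerXn2r; rewrite ?nnegrE.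
  - by rewrite !divr_ge0 // ltW.
  - by rewrite !divr_ge0 ?mulr_ge0 // ltW.
  have -> : 4 * Cp / eps / J%:R = Cp / (J%:R / 2) / (eps / 2).
    by field; rewrite !gt_eqF.
  apply: ler_pM.
  - by rewrite divr_ge0 // ltW.
  - by rewrite invr_ge0 ltW.
  - by rewrite ler_pM2l // lef_pV2 ?posrE // divr_gt0.
  - by rewrite lef_pV2 ?posrE ?divr_gt0 // /y ler_peMr // divr_ge0 // ltW.
have hA J := @union_bound _ _ _ P (2 ^ s.+1)%N (B J) (fun m => fine (P (B J m)))
  (fun m _ => mB J m) ltac:(by move=> m _; rewrite fineK // fin_num_measure).
have PA : \forall J \near \oo, (P (A J) <= (((2 ^ s.+1)%N%:R * K) * expR (- (1 + eps) * ln J%:R))%:E)%E.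
  exists J3 => //= J /= JJ; apply: (le_trans (hA J).2); rewrite lee_fin.
  apply: (@le_trans _ _ (\sum_(m < 2 ^ s.+1) (K * expR (- (1 + eps) * ln J%:R)))).
    by apply: ler_sum => m _; rewrite -lee_fin fineK ?fin_num_measure // PB.
  by rewrite sumr_const card_ord -mulrA mulr_natl.
have := borel_cantelli_power (fun J => (hA J).1) e0 PA.
apply: filterS => w [J4 _ hw].
exists (J3 + J4)%N => //= J /= JJ m /andP[m1 m2].
rewrite leNgt; apply/negP => h; apply: (hw J) => /=.
  exact: leq_trans (leq_addl _ _) JJ.
exists m => //; rewrite /B m1 (_ : (J3 <= J)%N) //.
exact: leq_trans (leq_addr _ _) JJ.
Qed.

(** With enough leading digits kept, both the chaining error and the variation of [g] over a block
    are at most [eps / 2] times [g (2 ^ J)], up to the scale. The total is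
    [(1 + eps) ^ 2 + eps <= 1 + 4 * eps]. *)
Lemma lil_upper (eps : R) : 0 < eps <= 1 ->
  {ae P, forall w, \forall n \near \oo, `|X n w| <= (1 + 4 * eps) * (g n * lil_scale n)}.
Proof.
move=> /andP[e0 e1].
have e2 : 0 < eps / 2 <= 1 by apply/andP; split; lra.
have e3 : 0 < eps / 2 / D by rewrite !divr_gt0.
have [s1 hs1] := expr_small rho01 e3.
have [s0 hs0] := g_floor e2.
pose s := (s0 + s1)%N.
have fl := hs0 s (leq_addr _ _).
have Ds : D * rho ^+ s <= eps / 2.
  have := hs1 s (leq_addl _ _).
  by rewrite ler_pdivlMr // mulrC.
have e01 : 0 < eps <= 1 by rewrite e0.
have bl := block_upper s e01.
apply: filterS2 bl X_chain => w hb hc.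
suff /near_window : \forall J \near \oo, forall n, (2 ^ J <= n < 2 ^ J.+1)%N ->
    `|X n w| <= (1 + 4 * eps) * (g n * lil_scale n).
  by apply: filterS => n [J nJ]; apply.
have dv := @dyadic_scale_ge1 R.
near=> J => n nJ.
have sJ : (i0 + s + 1 <= J)%N by near: J; exact: nbhs_infty_ge.
have d1 : 1 <= dyadic_scale J :> R by near: J.
have [m [ms mE]] := @dyadic_floor_block s J n ltac:(nlia) nJ.
have h1 : `|X (m * 2 ^ (J - s))%N w| <= (1 + eps) * g (m * 2 ^ (J - s))%N * dyadic_scale J.
  by move: m ms {mE}; near: J.
have h2 : `|X n w - X (dyadic_floor (J - s) n) w| <=
    D * rho ^+ (J - (J - s)) * (g (2 ^ J)%N * dyadic_scale J).
  have h : forall n I, (2 ^ J <= n < 2 ^ J.+1)%N -> (i0 <= I <= J)%N ->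
    `|X n w - X (dyadic_floor I n) w| <=
    D * rho ^+ (J - I) * (g (2 ^ J)%N * dyadic_scale J) by near: J.
  by apply: h => //; nlia.
have h3 : `|g n - g (dyadic_floor (J - s) n)| <= eps / 2 * g (2 ^ J)%N.
  by move: n nJ {mE h2}; near: J.
have /andP[h4 _] : g (2 ^ J)%N / 2 <= g n <= 4 * g (2 ^ J)%N.
  by move: n nJ {mE h2 h3}; near: J.
rewrite subKn in h2; last by nlia.
rewrite -mE in h1.
set N := dyadic_floor (J - s) n in h1 h2 h3.
have G0 := g0 (2 ^ J)%N; have gn0 := g0 n; have gN0 := g0 N.
set G := g (2 ^ J)%N in h2 h3 h4 G0.
have k1 : `|X n w| <= `|X N w| + `|X n w - X N w|.
  by have := ler_normD (X N w) (X n w - X N w); rewrite addrC subrK.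
have gN : g N <= (1 + eps) * g n.
  move: h3; rewrite ler_norml => /andP[h5 h6].
  have : eps * (G / 2) <= eps * g n by rewrite ler_wpM2l // ltW.
  lra.
have k2 : D * rho ^+ s * G <= eps * g n.
  apply: (le_trans (ler_wpM2r G0 Ds)).
  have : eps * (G / 2) <= eps * g n by rewrite ler_wpM2l // ltW.
  lra.
have k3 : (1 + eps) * g N + D * rho ^+ s * G <= (1 + 4 * eps) * g n.
  have : (1 + eps) * g N <= (1 + eps) * ((1 + eps) * g n) by rewrite ler_wpM2l //; lra.
  have : eps * (eps * g n) <= eps * g n by rewrite ler_piMl // mulr_ge0 // ltW.
  lra.
apply: (@le_trans _ _ ((1 + 4 * eps) * g n * dyadic_scale J)).
  apply: (le_trans k1); apply: (le_trans (lerD h1 h2)).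
  by rewrite mulrA -mulrDl ler_wpM2r //; lra.
rewrite -mulrA ler_wpM2l //; first by lra.
rewrite ler_wpM2l // dyadic_scale_le //; first by nlia.
by have /andP[] := nJ.
Unshelve. all: by end_near. Qed.

End upper.

(** * The times of (A4) *)

Section power_divergence.
Context {R : realType}.

Lemma powR_nat_dvg (al A : R) : 0 < al -> \forall k \near \oo, A <= (k%:R : R) `^ al.
Proof.
move=> al0.
have [N _ h] : \forall n \near \oo, `|A| `^ al^-1 <= (n%:R : R) by apply: nbhs_infty_ger.
exists N => //= k /h hk.
apply: (le_trans (ler_norm A)).
have -> : `|A| = (`|A| `^ al^-1) `^ al.
  by rewrite -powRrM mulVf ?gt_eqF // powRr1.
by apply: ge0_ler_powR; rewrite ?nnegrE ?powR_ge0 ?ler0n // ltW.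
Qed.

End power_divergence.

Section lil_times.
Context {R : realType} (q al : R).
Hypothesis q1 : 1 < q.
Hypothesis al0 : 0 < al.

(** The times [n_i] of (A4) as one sequence indexed by [k = m + i]. *)
Definition lil_times (k : nat) : nat := Num.truncn (q `^ (k%:R `^ (1 + al))).

Let lam := ln q.
Let E (k : nat) : R := k%:R `^ (1 + al).

Let lam0 : 0 < lam. Proof. exact: ln_gt0. Qed.
Let q0 : 0 < q. Proof. exact: lt_trans ltr01 q1. Qed.

Let qE k : q `^ (k%:R `^ (1 + al)) = expR (E k * lam).
Proof. by rewrite {1}/powR gt_eqF. Qed.

Let times_itv k : (lil_times k)%:R <= expR (E k * lam) < (lil_times k)%:R + 1.
Proof. by rewrite natr1 /lil_times qE truncn_itv // expR_ge0. Qed.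

Let E_split k : (0 < k)%N -> E k = k%:R * k%:R `^ al.
Proof.
move=> k0; rewrite /E powRD ?powRr1 //.
by apply/implyP => _; rewrite pnatr_eq0 -lt0n.
Qed.

Let E_mono k l : (k <= l)%N -> E k <= E l.
Proof.
move=> kl; apply: ge0_ler_powR; rewrite ?nnegrE ?ler0n ?ler_nat //.
by rewrite addr_ge0 // ltW.
Qed.

Let E_succ k : (0 < k)%N -> E k + k%:R `^ al <= E k.+1.
Proof.
move=> k0; rewrite !E_split // -natr1 mulrDl mul1r.
have h : k%:R `^ al <= (k%:R + 1) `^ al :> R.
  by apply: ge0_ler_powR; rewrite ?nnegrE ?ler0n ?addr_ge0 ?(ltW al0) // lerDl.
by apply: lerD => //; rewrite ler_wpM2l.
Qed.

Lemma lil_times_mono k l : (k <= l)%N -> (lil_times k <= lil_times l)%N.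
Proof.
by move=> kl; apply: le_truncn; rewrite !qE ler_expR ler_pM2r // E_mono.
Qed.

Lemma lil_times_dvg (M : nat) : \forall k \near \oo, (M <= lil_times k)%N.
Proof.
have [N _ h] := powR_nat_dvg (M%:R / lam) al0.
exists N.+1 => //= k /= Nk.
have k0 : (0 < k)%N by lia.
have /andP[_ h2] := times_itv k.
have h1 : M%:R / lam <= k%:R `^ al by apply: h => /=; lia.
have h3 : M%:R <= E k * lam.
  rewrite -ler_pdivrMr //; apply: (le_trans h1); rewrite E_split //.
  by rewrite ler_peMl ?powR_ge0 // ler1n.
have h4 := expR_ge1Dx (E k * lam).
have : M%:R < (lil_times k)%:R + 1 :> R by lra.
by rewrite natr1 ltr_nat ltnS.
Qed.

(** Consecutive exponents differ by at least [k ^ al], which diverges, so the ratio of consecutive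
    times exceeds any constant. *)
Lemma lil_times_sep (kap : nat) :
  \forall k \near \oo, (kap * lil_times k <= lil_times k.+1)%N.
Proof.
have [N _ h] := powR_nat_dvg (kap%:R / lam) al0.
have [N2 _ hd] := lil_times_dvg 1.
exists (N + N2).+1 => //= k /= Nk.
have k0 : (0 < k)%N by lia.
have t1 : (1 <= lil_times k)%N by apply: hd => /=; lia.
have /andP[h1 _] := times_itv k.
have /andP[_ h2] := times_itv k.+1.
have h3 : kap%:R / lam <= k%:R `^ al by apply: h => /=; lia.
have h4 : kap%:R + 1 <= expR (k%:R `^ al * lam).
  apply: le_trans (expR_ge1Dx _); rewrite addrC lerD2l.
  by rewrite -ler_pdivrMr.
have h5 : expR (E k * lam) * expR (k%:R `^ al * lam) <= expR (E k.+1 * lam).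
  by rewrite -expRD -mulrDl ler_expR ler_pM2r // E_succ.
have h6 : (lil_times k)%:R * (kap%:R + 1) <= expR (E k.+1 * lam).
  by apply: le_trans h5; apply: ler_pM => //; rewrite addr_ge0.
have h7 : (lil_times k * (kap + 1))%N%:R < (lil_times k.+1)%:R + 1 :> R.
  by rewrite natrM natrD; apply: le_lt_trans h6 h2.
by move: h7; rewrite natr1 ltr_nat; nia.
Qed.

(** A gap is at least as long as its left end, whose logarithm is about [lam * (m + 1) ^ (1 + al)].
    The product form lets [m] cancel against the number of increments in (A4). *)
Lemma ln_lil_times_gap : \forall m \near \oo,
  lam * (m%:R * m%:R `^ al) <= 1 + ln (lil_times (m + 2) - lil_times (m + 1))%N%:R.
Proof.
have [N _ h] := lil_times_sep 2.
have [N2 _ hd] := lil_times_dvg 1.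
exists (N + N2).+1 => //= m /= Nm.
have s := h (m + 1)%N ltac:(rewrite /=; lia).
have d := hd (m + 1)%N ltac:(rewrite /=; lia).
have -> : (m + 2 = (m + 1).+1)%N by lia.
have /andP[_ h2] := times_itv (m + 1).
set t := lil_times (m + 1) in s d h2 *.
set t' := lil_times (m + 1).+1 in s *.
have d1 : (1 : R) <= t%:R by rewrite ler1n.
(* Truncation costs at most 1, because [t + 1 <= 2 * t <= expR 1 * t]. *)
have h3 : E (m + 1) * lam - 1 <= ln t%:R.
  rewrite -ler_expR lnK ?posrE ?ltr0n // expRD expRN.
  rewrite ler_pdivrMr ?expR_gt0 //.
  have e2 := @expR1_ge2 R.
  apply: (le_trans (ltW h2)); apply: (@le_trans _ _ (t%:R * 2)); first by lra.
  by rewrite ler_wpM2l.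
have h4 : ln t%:R <= ln (t' - t)%N%:R :> R.
  by rewrite ler_ln ?posrE ?ltr0n ?ler_nat //; lia.
have h5 : m%:R * m%:R `^ al <= E (m + 1).
  by rewrite -E_split; [apply: E_mono; lia|lia].
have h6 : lam * (m%:R * m%:R `^ al) <= E (m + 1) * lam by rewrite mulrC ler_pM2r.
by rewrite -lerBlDl; apply: le_trans h4; apply: le_trans h3; rewrite lerD2r.
Qed.

Lemma ln_ln_lil_times : \forall k \near \oo,
  ln (ln (lil_times k)%:R) <= (1 + al) * ln k%:R + ln lam.
Proof.
have [N _ hd] := lil_times_dvg 2.
exists N.+1 => //= k /= Nk.
have k0 : (0 < k)%N by lia.
have d := hd k ltac:(rewrite /=; lia).
have /andP[h1 _] := times_itv k.
have h2 : ln (lil_times k)%:R <= E k * lam.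
  rewrite -[leRHS]expRK ler_ln ?posrE ?expR_gt0 // ltr0n; lia.
have l0 : 0 < ln (lil_times k)%:R :> R by rewrite ln_gt0 // ltr1n.
have Ek : 0 < E k by rewrite powR_gt0 // ltr0n.
have h3 : ln (ln (lil_times k)%:R) <= ln (E k * lam).
  by rewrite ler_ln ?posrE // mulr_gt0.
apply: (le_trans h3); rewrite lnM ?posrE // /E ln_powR.
by [].
Qed.

End lil_times.

(** The last product is [(1 - eps ^ 2) ^ 2]. It becomes the coefficient of [ln m] in the Gaussian
    exponent, and staying below [1 - eps ^ 2] leaves the diverging factor [m ^ (eps ^ 2)]. *)
Lemma lower_coef_bounds {R : realType} (eps : R) : 0 < eps < 1 ->
  [/\ 0 <= (1 + eps) * (1 - eps) ^+ 2, (1 + eps) * (1 - eps) ^+ 2 <= 1 &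
      (1 + eps) * (1 - eps) ^+ 2 * (1 + eps) <= 1 - eps ^+ 2].
Proof.
move=> /andP[e0 e1].
have h1 : 0 <= eps ^+ 2 * (1 - eps) by rewrite mulr_ge0 ?sqr_ge0 // subr_ge0 ltW.
have h2 : 0 <= eps ^+ 2 * (1 - eps) * (1 + eps) by rewrite mulr_ge0 // addr_ge0 // ltW.
by split; [rewrite mulr_ge0 ?sqr_ge0 // addr_ge0 // ltW|lra|lra].
Qed.

(** * The lower bound *)

Section lower.
Context {R : realType} (dO : measure_display) (Omega : measurableType dO)
  (P : probability Omega R) (X : nat -> {RV P >-> R}) (g : nat -> R)
  (h : nat -> nat) (lam sg eps Cal : R).
Hypothesis lam0 : 0 < lam.
Hypothesis h_mono : forall k l, (k <= l)%N -> (h k <= h l)%N.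
Hypothesis h_dvg : forall M, \forall k \near \oo, (M <= h k)%N.
Hypothesis h_sep : forall kap : nat, \forall k \near \oo, (kap * h k <= h k.+1)%N.
Hypothesis h_gap : \forall m \near \oo,
  lam * (m%:R * m%:R `^ eps) <= 1 + ln (h (m + 2) - h (m + 1))%N%:R.
Hypothesis h_lnln : \forall k \near \oo,
  ln (ln (h k)%:R) <= (1 + eps) * ln k%:R + ln lam.
Hypothesis sg1 : sg = 1 \/ sg = -1.
Hypothesis eps01 : 0 < eps < 1.
Let Y (m : nat) (w : Omega) (i : 'I_m) : R :=
  (X (h (m + (2 * i + 2))) w - X (h (m + (2 * i + 1))) w)
    / g (h (m + (2 * i + 2)) - h (m + (2 * i + 1)))%N.
Hypothesis A4 : forall d m : nat, (1 <= d)%N -> (1 <= m)%N ->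
  forall (dG : measure_display) (TG : measurableType dG)
       (PG : probability TG R) (G : TG -> vec d),
     std_gauss_vec PG G ->
     (wasserstein 1 P (fun w (i : 'I_d) =>
       ((X (h (m + (2 * i + 2))) w - X (h (m + (2 * i + 1))) w)
         / g (h (m + (2 * i + 2)) - h (m + (2 * i + 1)))%N)%R) PG G <=
        (d%:R * Cal / (1 + ln (h (m + 2) - h (m + 1))%N%:R))%:E)%E.

(** The window of [m] increments after index [m] ends at index [3 * m], so this common level
    dominates the level of each increment. *)
Let no_exceed (m : nat) : set Omega :=
  [set w | forall i : 'I_m, sg * Y w i <= (1 - eps) * lil_scale (h (3 * m))].

Let measurable_no_exceed m : measurable (no_exceed m).
Proof.
have -> : no_exceed m = \bigcap_(i in [set: 'I_m])
   [set w | sg * Y w i <= (1 - eps) * lil_scale (h (3 * m))].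
  by apply/seteqP; split => w /= H i; [move=> _|]; exact: H.
apply: fin_bigcap_measurable => // i _; apply: measurable_set_ler => //.
apply: measurable_funM => //; apply: measurable_funM => //.
exact: measurable_incr.
Qed.

(** Each of two errors takes half of [del]: the cost [r] of the coupling, of order [m ^ (- eps)],
    and the Gaussian product [(1 - tau) ^ m <= expR (- (m * tau))], where [m * tau] is at least of
    order [m ^ (eps ^ 2)]. *)
Lemma no_exceed_small (del : R) : 0 < del ->
  \forall m \near \oo, (P (no_exceed m) <= del%:E)%E.
Proof.
move=> d0; have /andP[e0 e1] := eps01.
(* Everything in [(x + 2) ^ 2 / 2] that does not grow with [m]: the 3 of [3 * m], the base [q]
   through [lam], and the constant of the inequality [k1] below. *)
pose c0 : R := 2 * ln 3 + `|ln lam| + 2 * (1 + eps^-1).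
pose pk : R := normal_peak 1.
have pk0 : 0 < pk by apply: normal_peak_gt0; rewrite oner_neq0.
have [N1 _ lnln] := h_lnln.
have pd1 := powR_nat_dvg (2 * (`|Cal| + 1) / (lam * del)) e0.
have ee0 : 0 < eps ^+ 2 by rewrite exprn_gt0.
have pd2 := powR_nat_dvg (2 / del * expR c0 / pk) ee0.
have [N2 _ ll1] := ln_ln_dvg (1 : R).
have [N3 _ hd] := h_dvg N2.
near=> m.
have m0 : (0 < m)%N by near: m; exact: nbhs_infty_gt.
have mN1 : (N1 <= m)%N by near: m; exact: nbhs_infty_ge.
have mN3 : (N3 <= m)%N by near: m; exact: nbhs_infty_ge.
have mR : (0 : R) < m%:R by rewrite ltr0n.
have gm : lam * (m%:R * m%:R `^ eps) <= 1 + ln (h (m + 2) - h (m + 1))%N%:R by near: m.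
have p1 : 2 * (`|Cal| + 1) / (lam * del) <= m%:R `^ eps by near: m.
have p2 : 2 / del * expR c0 / pk <= m%:R `^ (eps ^+ 2) by near: m.
set Lm := 1 + ln _ in gm.
have me0 : 0 < m%:R `^ eps :> R by rewrite powR_gt0.
have Lm0 : 0 < Lm by apply: lt_le_trans gm; rewrite !mulr_gt0.
(* [Cal] has no prescribed sign, and the added 1 makes the Wasserstein bound strict. *)
pose r := m%:R * (`|Cal| + 1) / Lm.
have C1 : 0 < `|Cal| + 1 by rewrite ltr_wpDl.
have r0 : 0 <= r by rewrite divr_ge0 ?mulr_ge0 // ltW.
have rd : r <= del / 2.
  rewrite /r ler_pdivrMr //.
  apply: (@le_trans _ _ (del / 2 * (lam * (m%:R * m%:R `^ eps)))); last first.
    by rewrite ler_pM2l // divr_gt0.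
  move: p1; rewrite ler_pdivrMr ?mulr_gt0 // => p1.
  have := ler_wpM2l (ltW mR) p1; lra.
pose x := (1 - eps) * lil_scale (h (3 * m)) : R.
have x0 : 0 <= x by rewrite mulr_ge0 ?sqrtr_ge0 //; lra.
have [dG [TG [PG [G gG]]]] := @std_gauss_vec_exists R m.
have Wr := A4 m0 m0 gG.
have Wlt : (wasserstein 1 P (fun w (i : 'I_m) => Y w i) PG G < r%:E)%E.
  apply: (le_lt_trans Wr); rewrite lte_fin /r ltr_pM2r ?invr_gt0 // ltr_pM2l //.
  by apply: le_lt_trans (ler_norm _) _; rewrite ltrDl.
apply: (le_trans (wasserstein_orthant r0 sg1 x0 gG Wlt)).
rewrite lee_fin.
set tau := _ * expR _.
(* [tau] is a lower bound for a probability; this keeps [1 - tau] nonnegative when powers are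
   compared. *)
have tau1 : tau <= 1.
  have x1 : 0 <= x + 1 by lra.
  have := normal_tail_ge sg1 x1.
  have -> : x + 1 + 1 = x + 2 by lra.
  move=> /le_trans/(_ (probability_le1 (normal_prob 0 1) _)); rewrite lee_fin; apply.
  by apply: measurable_set_ltr => //; exact: measurable_funM.
have tau0 : 0 < tau by rewrite mulr_gt0 // expR_gt0.
pose ll := ln (ln (h (3 * m))%:R) : R.
have ll0 : 1 <= ll by apply: ll1 => /=; apply: hd => /=; nlia.
have llm : ll <= (1 + eps) * ln (3 * m)%N%:R + ln lam by apply: lnln => /=; nlia.
have xE : x ^+ 2 = (1 - eps) ^+ 2 * (2 * ll).
  by rewrite /x exprMn sqr_sqrtr // mulr_ge0 // (le_trans ler01 ll0).
have lm0 : 0 <= ln m%:R :> R by rewrite ln_ge0 // ler1n.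
have l30 : 0 <= ln 3 :> R by rewrite ln_ge0 // ler1n.
have lm3 : ln (3 * m)%N%:R = ln 3 + ln m%:R :> R by rewrite natrM lnM ?posrE ?ltr0n.
have xb : (x + 2) ^+ 2 / 2 <= (1 - eps ^+ 2) * ln m%:R + c0.
  (* Young's inequality for the cross term [4 * x], read off from a square scaled by [eps^-1]. *)
  have k1 : (x + 2) ^+ 2 <= (1 + eps) * x ^+ 2 + 4 * (1 + eps^-1).
    have k2 : 0 <= eps^-1 * (eps * x - 2) ^+ 2 by rewrite mulr_ge0 ?sqr_ge0 ?invr_ge0 // ltW.
    have k3 : eps^-1 * (eps * x - 2) ^+ 2 = eps * x ^+ 2 - 4 * x + 4 * eps^-1.
      by field; rewrite gt_eqF.
    by rewrite k3 in k2; nra.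
  have k4 : (1 + eps) * x ^+ 2 / 2 = (1 + eps) * (1 - eps) ^+ 2 * ll by rewrite xE; field.
  set cc := (1 + eps) * (1 - eps) ^+ 2 in k4.
  have [cc0 cc1 cc2] := lower_coef_bounds eps01.
  rewrite -/cc in cc0 cc1 cc2.
  have k5 : cc * ll <= cc * ((1 + eps) * (ln 3 + ln m%:R) + ln lam).
    by rewrite ler_wpM2l // -lm3.
  have k6 : cc * (1 + eps) * ln m%:R <= (1 - eps ^+ 2) * ln m%:R by rewrite ler_wpM2r.
  have k7 : cc * (1 + eps) * ln 3 <= 2 * ln 3.
    by rewrite ler_wpM2r // (le_trans cc2) // lerBlDr (le_trans (_ : 1 <= 2)) ?ler1n // lerDl ltW.
  have k8 : cc * ln lam <= `|ln lam|.
    apply: (@le_trans _ _ (cc * `|ln lam|)); first by rewrite ler_wpM2l // ler_norm.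
    by rewrite ler_piMl.
  rewrite /c0; move: k1 k4 k5 k6 k7 k8; set l3 := ln 3; set lm := ln m%:R; lra.
have tm : 2 / del <= tau * m%:R.
  have -> : tau * m%:R = pk * expR (ln m%:R - (x + 2) ^+ 2 / 2).
    by rewrite expRD lnK ?posrE // /tau -/pk mulNr; ring.
  have k1 : expR (eps ^+ 2 * ln m%:R - c0) <= expR (ln m%:R - (x + 2) ^+ 2 / 2).
    rewrite ler_expR; move: xb; set u := (x + 2) ^+ 2 / 2; set lm := ln m%:R; lra.
  apply: le_trans (ler_wpM2l (ltW pk0) k1).
  rewrite expRD expRN.
  have -> : expR (eps ^+ 2 * ln m%:R) = m%:R `^ (eps ^+ 2) by rewrite /powR gt_eqF.
  move: p2; rewrite ler_pdivrMr // => p2.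
  by rewrite mulrA ler_pdivlMr ?expR_gt0 // [leRHS]mulrC.
have t2 : (1 - tau) ^+ m <= del / 2.
  apply: (@le_trans _ _ (expR (- tau) ^+ m)).
    apply: lerXn2r; rewrite ?nnegrE ?expR_ge0 ?subr_ge0 //.
    exact: expR_ge1Dx.
  rewrite -expRM_natl mulrN expRN.
  have k1 : 2 / del <= expR (m%:R * tau).
    by apply: (le_trans tm); rewrite mulrC; have := expR_ge1Dx (m%:R * tau); lra.
  have -> : del / 2 = (2 / del)^-1 by field; rewrite gt_eqF.
  by rewrite lef_pV2 ?posrE ?expR_gt0 ?divr_gt0.
by move: t2 rd; set u := (1 - tau) ^+ m; lra.
Unshelve. all: by end_near. Qed.

(* The windows escape to infinity and each fails with probability tending to 0,
   so no independence, hence no second Borel-Cantelli lemma, is needed. *)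
Lemma incr_exceed_io : {ae P, forall w, forall M, exists2 k, (M <= k)%N &
  (1 - eps) * lil_scale (h k.+1) <
    sg * ((X (h k.+1) w - X (h k) w) / g (h k.+1 - h k)%N)}.
Proof.
have /andP[e0 e1] := eps01.
have [N3 _ hd] := h_dvg 3.
apply/ae_foralln => M.
pose B := \bigcap_(m in [set m | (M + N3 + 1 <= m)%N]) no_exceed m.
have mB : measurable B by apply: bigcap_measurable => //; exists (M + N3 + 1)%N => /=.
exists B; split => //.
  apply/eqP; rewrite eq_le measure_ge0 andbT; apply/lee_addgt0Pr => del d0.
  rewrite add0e.
  have [N _ hN] := no_exceed_small d0.
  apply: le_trans (hN (N + (M + N3 + 1))%N _); last exact: leq_addr.
  apply: le_measure; rewrite ?inE //.
  by move=> w; apply => /=; exact: leq_addl.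
move=> w /= nw m /= mM i; rewrite leNgt; apply/negP => hi; apply: nw.
exists (m + (2 * i + 1))%N; first by nlia.
have -> : (m + (2 * i + 1)).+1 = (m + (2 * i + 2))%N by nlia.
apply: le_lt_trans hi; rewrite ler_wpM2l ?subr_ge0 ?(ltW e1) //.
have im := ltn_ord i.
apply: lil_scale_mono; first by apply: hd => /=; nlia.
by apply: h_mono => //; nlia.
Qed.

Hypothesis X_upper : {ae P, forall w, \forall n \near \oo, `|X n w| <= 5 * (g n * lil_scale n)}.
Hypothesis g_sep : exists2 kap : nat, (0 < kap)%N &
  \forall n' \near \oo, forall n, (kap * n' <= n)%N ->
    [/\ 0 < g n', 0 < g n, g n' <= eps * g n & (1 - eps) * g n <= g (n - n')%N].

(** 7 = 2 + 5: the level and the normalization of the increment each lose [eps], and the value at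
    its left end is at most [5 * eps] times the target scale. *)
Lemma lil_lower : {ae P, forall w, forall M, exists2 n, (M <= n)%N &
  (1 - 7 * eps) * (g n * lil_scale n) <= sg * X n w}.
Proof.
have /andP[e0 e1] := eps01.
have sgE : `|sg| = 1 by case: sg1 => ->; rewrite ?normrN normr1.
apply: filterS2 incr_exceed_io X_upper => w hio [N1 _ hup] M.
have [kap kap0 [N2 _ hsep]] := g_sep.
have [K1 _ hk1] := h_dvg (M + N1 + N2 + 3)%N.
have [K2 _ hk2] := h_sep kap.
have [k Kk hk] := hio (K1 + K2)%N.
have t1 := hk1 k ltac:(rewrite /=; nlia).
have t2 := hk2 k ltac:(rewrite /=; nlia).
have t3 : (h k <= h k.+1)%N by exact: h_mono.
move: hk t1 t2 t3; move: (h k.+1) (h k) => n n' hk t1 t2 t3.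
exists n; first by nlia.
have [g1 g2 g3 g4] := hsep n' ltac:(rewrite /=; nlia) n t2.
have u1 := hup n' ltac:(rewrite /=; nlia).
have s1 : lil_scale n' <= lil_scale n :> R by apply: lil_scale_mono; nlia.
have s0 : 0 <= lil_scale n' :> R by exact: sqrtr_ge0.
have S0 : 0 <= lil_scale n :> R by exact: sqrtr_ge0.
have gl : 0 < g (n - n')%N by apply: lt_le_trans g4; rewrite mulr_gt0 // subr_gt0.
move: hk; rewrite mulrA ltr_pdivlMr // mulrBr => hk.
have a1 : - (sg * X n' w) <= `|X n' w|.
  by rewrite -[leRHS]mul1r -sgE -normrM -normrN; exact: ler_norm.
have a2 : g n' * lil_scale n' <= eps * (g n * lil_scale n).
  by rewrite mulrA; apply: ler_pM => //; exact: ltW.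
have a3 : (1 - eps) * ((1 - eps) * (g n * lil_scale n)) <= (1 - eps) * lil_scale n * g (n - n')%N.
  rewrite -[leRHS]mulrA ler_wpM2l ?subr_ge0 ?(ltW e1) // mulrA [leRHS]mulrC.
  by rewrite ler_wpM2r.
set Z := g n * lil_scale n in a2 a3 *.
have Z0 : 0 <= Z by rewrite mulr_ge0 // ltW.
have a4 : 0 <= eps * (eps * Z) by rewrite !mulr_ge0 // ltW.
by lra.
Qed.

End lower.

(** * Identification of the limits *)

Lemma limn_esup_eq {R : realType} (u : nat -> R) (l : R) :
  (forall e : R, 0 < e -> \forall n \near \oo, u n <= l + e) ->
  (forall e : R, 0 < e -> forall M, exists2 n, (M <= n)%N & l - e <= u n) ->
  limn_esup (fun n => (u n)%:E) = l%:E.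
Proof.
move=> hu hl; rewrite /limn_esup limf_esupE; apply/eqP; rewrite eq_le; apply/andP; split.
  apply/lee_addgt0Pr => e e0.
  have h := hu e e0.
  apply: (@le_trans _ _ (ereal_sup [set (u n)%:E | n in [set n | u n <= l + e]])).
    by apply: ereal_inf_lbound; exists [set n | u n <= l + e].
  by apply: ge_ereal_sup => _ [n /= hn <-]; rewrite lee_fin.
apply: le_ereal_inf_tmp => _ [V [M _ MV] <-].
apply/lee_addgt0Pr => e e0.
have [n Mn hn] := hl e e0 M.
rewrite -leeBlDr //; apply: (@le_trans _ _ (u n)%:E); first by rewrite -EFinB lee_fin.
by apply: ereal_sup_ubound; exists n => //; exact: MV.
Qed.

Theorem theorem2p2 (R : realType) (dO : measure_display) (Omega : measurableType dO)
  (P : probability Omega R) (X : nat -> {RV P >-> R})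
  (g : nat -> R) (L : R -> R) (a : R) :
  (forall w, X 0%N w = 0) ->
  (forall n : nat, (1 <= n)%N -> ('E_P[X n] = 0)%E) ->
  (* (A1) *)
  (forall n, 0 <= g n) ->
  slowly_varying L -> 0 < a <= 1 ->
  asympt_equiv g (fun n => n%:R `^ a * L n%:R) ->
  (exists2 C : R, 0 < C & forall n1 n2 : nat, (n1 < n2)%N ->
     (`| \int[P]_w (((X n2 w - X n1 w) / g (n2 - n1)%N) ^+ 2)%:E - 1 |
       <= (C / (1 + ln (n2 - n1)%N%:R))%:E)%E) ->
  (* (A2) *)
  (forall n p : nat, (1 <= n)%N -> (1 <= p)%N ->
     (limn_esup (fun k => \int[P]_w ((X (k + n)%N w - X k w) ^+ (2 * p))%:E)
       < +oo)%E) ->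
  (* (A3) *)
  (exists C lam : R, [/\ 0 < C, 0 < lam &
     forall (dG : measure_display) (TG : measurableType dG)
       (PG : probability TG R) (G : TG -> vec 1),
     std_gauss_vec PG G ->
     forall n1 n2 : nat, (n1 < n2)%N ->
     let Z : Omega -> vec 1 :=
       fun w _ => (X n2 w - X n1 w) / g (n2 - n1)%N in
     (forall theta : R, 1 <= theta ->
        (wasserstein theta P Z PG G <=
          (C * alphaW theta * theta `^ lam / (1 + ln (n2 - n1)%N%:R))%:E)%E) /\
     (kolmogorov P Z PG G <= (C / (1 + ln (n2 - n1)%N%:R))%:E)%E]) ->
  (* (A4) *)
  (exists2 q : R, 1 < q & forall al : R, 0 < al -> exists Cal : R,
     forall d m : nat, (1 <= d)%N -> (1 <= m)%N ->
     let n : nat -> nat := fun i => Num.truncn (q `^ ((m + i)%N%:R `^ (1 + al))) in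
     let Y : Omega -> vec d := fun w (i : 'I_d) =>
       (X (n (2 * i + 2)%N) w - X (n (2 * i + 1)%N) w)
         / g (n (2 * i + 2)%N - n (2 * i + 1)%N)%N in
     forall (dG : measure_display) (TG : measurableType dG)
       (PG : probability TG R) (G : TG -> vec d),
     std_gauss_vec PG G ->
     (wasserstein 1 P Y PG G <=
        (d%:R * Cal / (1 + ln (n 2%N - n 1%N)%N%:R))%:E)%E) ->
  {ae P, forall w,
     limn_esup (fun n => (X n w / Num.sqrt (2 * g n ^+ 2 * ln (ln n%:R)))%:E)
       = 1%E /\
     limn_einf (fun n => (X n w / Num.sqrt (2 * g n ^+ 2 * ln (ln n%:R)))%:E)
       = (-1)%E}.
Proof.
move=> X0 _ g0 slowL a01 gL [C C0 A1] A2 [C3 [lam [C30 _ A3]]] [q q1 A4].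
have gp := regular_gt0 g0 gL.
have [rho [i0 [rho01 gpos ggrow]]] := regular_dyadic_growth g0 slowL a01 gL.
have gblock := regular_block g0 slowL a01 gL.
have C1 : 0 <= 1 + C by rewrite addr_ge0 // ltW.
have Nle := incr_norm_le C0 A1.
have Nasy := fun eta => @incr_norm_asympt _ _ _ _ _ _ _ C0 A1 eta gp.
have Nsmall := incr_norm_small A2.
have tail := incr_gauss_tail C30 (fun dG TG PG G gG n1 n2 n12 => (A3 dG TG PG G gG n1 n2 n12).1).
have mom := incr_moment_tail A2.
have floor := regular_dyadic_floor g0 rho01 gpos ggrow gblock (@incr_norm_tri _ _ _ _ X)
  (@incr_norm_sym _ _ _ _ X) (@incr_norm_diag _ _ _ _ X) C1 Nle Nasy Nsmall.
have window := regular_window g0 rho01 gpos ggrow gblock (@incr_norm_tri _ _ _ _ X)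
  (@incr_norm_sym _ _ _ _ X) (@incr_norm_diag _ _ _ _ X) C1 Nle Nasy Nsmall.
have sep := regular_separated g0 rho01 gpos ggrow gblock (@incr_norm_tri _ _ _ _ X)
  (@incr_norm_sym _ _ _ _ X) (@incr_norm_diag _ _ _ _ X) C1 Nle Nasy Nsmall.
have [D D0 chain] := chaining g0 rho01 gpos ggrow tail mom.
have upper := lil_upper X0 g0 rho01 gp tail floor window D0 chain.
(* The case [eps = 1]. A crude constant is enough at the left end of an increment, where [g] is
   smaller by a factor [eps]. *)
have upper5 : {ae P, forall w, \forall n \near \oo, `|X n w| <= 5 * (g n * lil_scale n)}.
  have e1 : 0 < (1 : R) <= 1 by rewrite ltr01 lexx.
  have -> : 5 = 1 + 4 * 1 :> R by lra.
  exact: upper e1.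
have lower (sg : R) (sg1 : sg = 1 \/ sg = -1) (eps : R) (eps01 : 0 < eps < 1) :
    {ae P, forall w, forall M, exists2 n, (M <= n)%N &
      (1 - 7 * eps) * (g n * lil_scale n) <= sg * X n w}.
  have /andP[e0 _] := eps01.
  (* The exponent of (A4) is tied to the precision: [al = eps]. *)
  have [Cal hC] := A4 eps e0.
  exact: (lil_lower (ln_gt0 q1) (lil_times_mono q1 e0) (lil_times_dvg q1 e0)
    (lil_times_sep q1 e0) (ln_lil_times_gap q1 e0) (ln_ln_lil_times q1 e0) sg1 eps01
    hC upper5 (sep eps eps01)).
(* Countably many precisions, so that their null sets can be united; [j.+2] keeps them strictly
   below 1. *)
pose ej (j : nat) : R := j.+2%:R^-1.
have ej01 j : 0 < ej j < 1 by rewrite invr_gt0 ltr0n invf_lt1 ?ltr0n // ltr1n.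
have ejle j : 0 < ej j <= 1 by have /andP[-> /ltW] := ej01 j.
have ej_small (e : R) : 0 < e -> exists j, 7 * ej j <= e.
  move=> e0; have [N _ h] : \forall n \near \oo, 7 / e <= (n%:R : R) by apply: nbhs_infty_ger.
  exists N; rewrite /ej ler_pdivrMr ?ltr0n // mulrC -ler_pdivrMr //.
  by apply: (le_trans (h N (leqnn N))); rewrite ler_nat -addn2 leq_addr.
have hU : {ae P, forall w, forall j, \forall n \near \oo,
    `|X n w| <= (1 + 4 * ej j) * (g n * lil_scale n)}.
  by apply/ae_foralln => j; exact: upper (ejle j).
have hL (sg : R) (sg1 : sg = 1 \/ sg = -1) : {ae P, forall w, forall j, forall M,
    exists2 n, (M <= n)%N & (1 - 7 * ej j) * (g n * lil_scale n) <= sg * X n w}.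
  by apply/ae_foralln => j; exact: lower.
apply: filterS3 hU (hL 1 (or_introl erefl)) (hL (-1) (or_intror erefl)) => w u_ l1 l2.
have [N0 _ den] : \forall n \near \oo, 0 < g n * lil_scale n /\
    Num.sqrt (2 * g n ^+ 2 * ln (ln n%:R)) = g n * lil_scale n.
  have s1 := @lil_scale_ge1 R.
  near=> n; have gn : 0 < g n by near: n.
  have sn : 1 <= @lil_scale R n by near: n.
  split; first by rewrite mulr_gt0 // (lt_le_trans ltr01 sn).
  by rewrite (mulrC 2) -mulrA sqrtrM ?sqr_ge0 // sqrtr_sqr gtr0_norm.
(* [limn_einf] is minus the [limn_esup] of the negated sequence, so [sg = -1] settles the limit
   inferior. *)
have key (sg : R) : sg = 1 \/ sg = -1 ->
    (forall j M, exists2 n, (M <= n)%N & (1 - 7 * ej j) * (g n * lil_scale n) <= sg * X n w) ->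
    limn_esup (fun n => (sg * (X n w / Num.sqrt (2 * g n ^+ 2 * ln (ln n%:R))))%:E) = 1%E.
  move=> sg1 l; apply: limn_esup_eq => e e0; have [j hj] := ej_small e e0.
    have [N1 _ hN1] := u_ j.
    exists (N0 + N1)%N => //= n /= Nn.
    have [d1 d2] := den n (leq_trans (leq_addr _ _) Nn).
    rewrite d2 mulrA ler_pdivrMr //.
    apply: (@le_trans _ _ `|X n w|).
      rewrite -[leRHS]mul1r (_ : 1 = `|sg|); last by case: sg1 => ->; rewrite ?normrN normr1.
      by rewrite -normrM ler_norm.
    apply: (le_trans (hN1 n (leq_trans (leq_addl _ _) Nn))).
    rewrite ler_pM2r // lerD2l; apply: le_trans hj.
    by rewrite ler_pM2r ?ler_nat //; have /andP[] := ej01 j.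
  move=> M; have [n Mn hn] := l j (M + N0)%N.
  exists n; first exact: leq_trans (leq_addr _ _) Mn.
  have [d1 d2] := den n (leq_trans (leq_addl _ _) Mn).
  rewrite d2 mulrA ler_pdivlMr //; apply: le_trans hn.
  by rewrite ler_pM2r // lerB.
split.
  by have := key 1 (or_introl erefl) l1; under eq_fun do rewrite mul1r.
rewrite /limn_einf.
have -> : (fun n => (- (X n w / Num.sqrt (2 * g n ^+ 2 * ln (ln n%:R)))%R%:E)%E) =
    (fun n => (-1 * (X n w / Num.sqrt (2 * g n ^+ 2 * ln (ln n%:R))))%:E).
  by apply/funext => n; rewrite mulN1r EFinN.
by rewrite (key (-1) (or_intror erefl) l2).
Unshelve. all: by end_near. Qed.
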